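(* Let $f\in C^r(\mathbb{R})$, $r\ge 2$, be such that either $f''(x)>0$ for all $x\in\mathbb{R}$ or $f''(x)<0$ for all $x\in\mathbb{R}$. Let $X=H^2_D([0,\pi])$, and for $\theta\in\mathbb{R}$ let $M_\theta=\{u\in X:\ W(u)(\pi)=\theta\}$, and $C_j=M_{j\pi}$ for $j\in\{1,2,3,\ldots\}$, where $W(u)$ is the argument function defined in the context. Let $p\in X$ be any function that is strictly positive on $(0,\pi)$, let $V=\mathbb{R}p$ be the span of $p$, let $H=\{h\in X:\ \int_0^\pi h(t)p(t)\,dt=0\}$, so that $X=H\oplus V$ is an $L^2$-orthogonal decomposition, and let $\Pi:X=H\oplus V\to H$ be the corresponding projection. Then: (1) For every $j\in\{1,2,3,\ldots\}$, $C_j\neq\emptyset$ if and only if $-j^2$ belongs to the interior of the image of $f'$. (2) For every $\theta\in\mathbb{R}$ with $M_\theta\neq\emptyset$ (in particular for $\theta=k\pi$ whenever $C_k\neq\emptyset$), the restriction of $\Pi$ to $M_\theta$ is a diffeomorphism from $M_\theta$ onto $H$.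
   Context: $X=H^2_D([0,\pi])$ is the Sobolev space of real functions $u$ on $[0,\pi]$ with $u,u',u''\in L^2([0,\pi])$ and $u(0)=u(\pi)=0$, with its usual $H^2$ norm; $H$ carries the norm induced from $X$. For $u\in X$, let $v(u)$ be the solution on $[0,\pi]$ of the linear initial value problem $-v''(t)+f'(u(t))v(t)=0$, $v(0)=0$, $v'(0)=1$. The argument function $W(u):[0,\pi]\to\mathbb{R}$ is the unique continuous function with $W(u)(0)=0$ such that, for every $t$, $W(u)(t)$ is an argument (polar angle) of the nonzero planar vector $(v(u)'(t),\,v(u)(t))$, i.e. $(v(u)'(t),v(u)(t))=\rho(t)(\cos W(u)(t),\sin W(u)(t))$ with $\rho(t)>0$. The union of the sets $C_j$ is the critical set of the operator $F:X\to L^2([0,\pi])$, $F(u)=-u''+f(u)$. Under the hypothesis on $f''$, each non-empty $M_\theta$ is a (at least $C^1$) submanifold of codimension $1$ in $X$; ''diffeomorphism'' is meant with respect to this submanifold structure, i.e. a bijection that is $C^1$ with $C^1$ inverse. *)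

(* Defs.v *)
From HB Require Import structures.
From mathcomp Require Import all_boot all_order all_algebra.
From mathcomp Require Import all_classical all_reals all_analysis.
From mathcomp Require Import measurable_realfun.
From mathcomp Require Import ring lra.
Set Implicit Arguments.
Unset Strict Implicit.
Unset Printing Implicit Defensive.
Import Order.TTheory GRing.Theory Num.Theory.
Import numFieldNormedType.Exports.
Local Open Scope classical_set_scope.
Local Open Scope ring_scope.

Section SquareIntegrable.
Variable R : realType.
Implicit Types (g h u a b : R -> R) (t : R).
Local Notation mu := (@lebesgue_measure R).
Let D : set R := `[0, pi].

Let fm : Filter (almost_everywhere mu).
Proof. exact: ae_filter_ringOfSetsType. Qed.

Let aeS (P Q : R -> Prop) : (forall t, P t -> Q t) ->
  {ae mu, forall t, P t} -> {ae mu, forall t, Q t}.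
Proof. exact: (@filterS _ _ fm). Qed.

Let aeI (P Q : R -> Prop) : {ae mu, forall t, P t} -> {ae mu, forall t, Q t} ->
  {ae mu, forall t, P t /\ Q t}.
Proof. exact: (@filterI _ _ fm). Qed.

Let aeC x : {ae mu, forall t : R, t != x}.
Proof.
exists [set x]; split; [exact: measurable_set1|exact: lebesgue_measure_set1|].
by move=> t /= /negP/negPn/eqP.
Qed.

Definition sqint g : Prop :=
  measurable_fun D g /\ mu.-integrable D (EFin \o (fun t => g t ^+ 2)).

(* integral over [0, pi] of g * h *)
Definition l2prod g h : R := \int[mu]_(t in D) (g t * h t).

Let mD : measurable (D : set (measurableTypeR R)).
Proof. exact: measurable_itv. Qed.

Lemma sqint_prod g h : sqint g -> sqint h ->
  mu.-integrable D (EFin \o (fun t => g t * h t)).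
Proof.
move=> [mg ig] [mh ih].
have := integrableD mD ig ih; apply: (le_integrable mD).
  by apply/measurable_EFinP; apply: measurable_funM.
move=> t _ /=; rewrite lee_fin.
rewrite [leRHS]ger0_norm; last by rewrite addr_ge0 ?sqr_ge0.
rewrite normrM -(real_normK (num_real (g t))) -(real_normK (num_real (h t))).
have := sqr_ge0 (`|g t| - `|h t|).
have : 0 <= `|g t| by []. have : 0 <= `|h t| by [].
move: `|g t| `|h t| => x y; nra.
Qed.

Lemma sqint0 : sqint (fun=> 0).
Proof.
split; first exact: measurable_cst.
under [X in integrable _ _ X]eq_fun do rewrite /= expr0n /=.
exact: integrable0.
Qed.

Lemma sqint_lin (k : R) g h : sqint g -> sqint h ->
  sqint (fun t => k * g t + h t).
Proof.
move=> sg sh; have [mg ig] := sg; have [mh ih] := sh.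
have igh := sqint_prod sg sh.
split.
  by apply: measurable_funD => //; apply: measurable_funM => //;
    exact: measurable_cst.
pose G1 t := (g t ^+ 2)%:E; pose G2 t := (g t * h t)%:E.
pose G3 t := (h t ^+ 2)%:E.
have -> : EFin \o (fun t => (k * g t + h t) ^+ 2) =
  ((fun t => (k ^+ 2)%:E * G1 t) \+ ((fun t => (k *+ 2)%:E * G2 t) \+ G3))%E.
  by apply/funext => t /=; rewrite -!EFinM -!EFinD; congr (_%:E); ring.
apply: integrableD => //; first exact: integrableZl.
by apply: integrableD => //; exact: integrableZl.
Qed.

Lemma sqint_integrable g : sqint g -> mu.-integrable D (EFin \o g).
Proof.
move=> sg.
have s1 : sqint (fun=> 1).
  split; first exact: measurable_cst.
  under [X in integrable _ _ X]eq_fun do rewrite /= expr1n.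
  apply: continuous_compact_integrable; first exact: segment_compact.
  by apply: continuous_subspaceT => x; exact: cvg_cst.
have := sqint_prod sg s1.
by under [X in integrable _ _ X -> _]eq_fun do rewrite /= mulr1.
Qed.

Lemma l2prodC g h : l2prod g h = l2prod h g.
Proof. by apply: eq_Rintegral => t _; rewrite mulrC. Qed.

Lemma l2prod_ge0 g : 0 <= l2prod g g.
Proof. by apply: Rintegral_ge0 => t _; rewrite -expr2 sqr_ge0. Qed.

Lemma l2prod_linl (k : R) g h a : sqint g -> sqint h -> sqint a ->
  l2prod (fun t => k * g t + h t) a = k * l2prod g a + l2prod h a.
Proof.
move=> sg sh sa; rewrite /l2prod -RintegralZl//; last exact: sqint_prod.
rewrite -RintegralD//; last exact: sqint_prod.
  by apply: eq_Rintegral => t _; ring.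
have := sqint_prod (sqint_lin k sg sqint0) sa.
by under [X in integrable _ _ X -> _]eq_fun do rewrite /= addr0 -mulrA.
Qed.

Lemma l2prod_eq0 g : sqint g -> l2prod g g = 0 ->
  {ae mu, forall t, D t -> g t = 0}.
Proof.
move=> [mg ig] g0.
pose G t := (g t ^+ 2)%:E.
have G0 : (\int[mu]_(x in D) `|G x| = 0)%E.
  under eq_integral do rewrite abse_EFin ger0_norm ?sqr_ge0//.
  have fi := integrable_fin_num mD ig.
  rewrite -[LHS](fineK fi); congr (_%:E).
  rewrite -[RHS]g0; apply: eq_Rintegral => t _ /=; exact: expr2.
have mG : measurable_fun (D : set (measurableTypeR R)) G.
  by case/integrableP : ig.
have [/(_ G0) + _] := ae_eq_integral_abs mu mD mG.
by apply: aeS => t /[apply] -[] /eqP; rewrite sqrf_eq0 => /eqP.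
Qed.

Lemma l2prod_ae g h a b : sqint g -> sqint h -> sqint a -> sqint b ->
  {ae mu, forall t, D t -> g t = a t} -> {ae mu, forall t, D t -> h t = b t} ->
  l2prod g h = l2prod a b.
Proof.
move=> sg sh sa sb ga hb; congr fine; apply: ae_eq_integral => //.
- by have /integrableP[] := sqint_prod sg sh.
- by have /integrableP[] := sqint_prod sa sb.
by apply: aeS (aeI ga hb) => t [{}ga {}hb] Dt /=; rewrite ga// hb.
Qed.

(* [u] is absolutely continuous on [0, pi] and its derivative is [g], an      *)
(* element of L^2 (so [g] is only determined almost everywhere).              *)
Definition is_ac_deriv u g : Prop :=
  sqint g /\ forall t, D t -> u t = u 0 + \int[mu]_(s in `[0, t]) g s.

Definition is_H2_deriv u (d : (R -> R) * (R -> R)) : Prop :=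
  is_ac_deriv u d.1 /\ is_ac_deriv d.1 d.2.

(* Functions on [0, pi] with zero boundary values are represented by their    *)
(* extension by zero to the whole line.                                       *)
Definition H2D_fun u : Prop :=
  [/\ sqint u, exists d, is_H2_deriv u d, u 0 = 0, u pi = 0
    & forall t, t \notin `[0, pi] -> u t = 0].

(* a choice of the pair (u', u''); u'' is determined almost everywhere *)
Definition H2_deriv u : (R -> R) * (R -> R) :=
  xget (fun=> 0, fun=> 0) [set d | is_H2_deriv u d].

Definition H2_norm u : R :=
  let d := H2_deriv u in
  Num.sqrt (l2prod u u + l2prod d.1 d.1 + l2prod d.2 d.2).

Let D0 : D 0. Proof. by rewrite /D /= in_itv /= lexx pi_ge0. Qed.

Let subD t : D t -> `[0, t] `<=` D.
Proof.
rewrite /D /= in_itv /= => /andP[_ tp] x /=.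
by rewrite !in_itv /= => /andP[-> /le_trans]; apply.
Qed.

Lemma ac_deriv_lin (k : R) u v a b : is_ac_deriv u a -> is_ac_deriv v b ->
  is_ac_deriv (fun t => k * u t + v t) (fun t => k * a t + b t).
Proof.
move=> [sa ua] [sb vb]; split; first exact: sqint_lin.
move=> t Dt; rewrite ua// vb//.
have iS g : sqint g -> mu.-integrable `[0, t] (EFin \o g).
  move=> sg; apply: (integrableS _ _ _ (sqint_integrable sg)) => //.
  exact: subD.
rewrite RintegralD//; [| |exact: iS].
  by rewrite RintegralZl//; [ring|exact: iS].
have := iS _ (sqint_lin k sa sqint0).
by under [X in integrable _ _ X -> _]eq_fun do rewrite /= addr0.
Qed.

Lemma H2_deriv_lin (k : R) u v d e : is_H2_deriv u d -> is_H2_deriv v e ->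
  is_H2_deriv (fun t => k * u t + v t)
    ((fun t => k * d.1 t + e.1 t), (fun t => k * d.2 t + e.2 t)).
Proof. by move=> [u1 u2] [v1 v2]; split => /=; exact: ac_deriv_lin. Qed.

Let intD_cst g (k : R) : mu.-integrable D (EFin \o g) ->
  (forall t, t \in `]0, pi[ -> \int[mu]_(s in `[0, t]) g s = k) ->
  forall x, x \in `]0, pi[ -> lebesgue_pt g x -> g x = 0.
Proof.
move=> ig gk x xp lx.
have [x0 xpi] : 0 < x /\ x < pi by move: xp; rewrite in_itv => /andP[].
have [dF <-] := FTC1_lebesgue_pt (a := BLeft 0) xpi ig x0 lx.
rewrite derive1E [RHS](_ : 0 = 'D_1 (cst k) x); last by rewrite derive_cst.
apply: near_eq_derive; near=> y.
have yp : y \in `]0, pi[.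
  by rewrite in_itv /=; apply/andP; split; near: y;
    [exact: lt_nbhsr|exact: lt_nbhsl].
exact: gk.
Unshelve. all: by end_near. Qed.

Lemma ac_deriv_cst g (k : R) : sqint g ->
  (forall t, t \in `]0, pi[ -> \int[mu]_(s in `[0, t]) g s = k) ->
  {ae mu, forall t, D t -> g t = 0}.
Proof.
move=> sg gk; have ig := sqint_integrable sg.
have mD' : measurable D by exact: measurable_itv.
have lg := lebesgue_differentiation (integrable_locally mD' ig).
apply: aeS (aeI lg (aeI (aeC 0) (aeC pi))) => t [lt [t0 tpi]] Dt.
have Dt' : t \in `]0, pi[.
  by move: Dt; rewrite /D /= !in_itv /= !lt_neqAle (eq_sym 0) t0 tpi.
have -> : g t = (g \_ D) t by rewrite patchE mem_set.
apply: (@intD_cst _ k) => //.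
  by rewrite -restrict_EFin; apply/integrable_restrict => //=; rewrite setIid.
move=> x xp; rewrite -(gk x xp); apply: eq_Rintegral => y /set_mem /= yx.
rewrite patchE mem_set//; apply: subD yx.
by move: xp; rewrite /D /= !in_itv /= => /andP[/ltW-> /ltW->].
Qed.

Let ac_deriv_continuous u g : is_ac_deriv u g ->
  {within D, continuous u}.
Proof.
move=> [sg ug].
have := parameterized_integral_continuous (pi_ge0 R) (sqint_integrable sg).
move=> cI.
apply: (@subspace_eq_continuous _ _ _
  (fun x => u 0 + parameterized_integral mu 0 x g)).
  by move=> x /set_mem Dx; rewrite /= [RHS]ug.
move=> x; apply: cvgD; first exact: cvg_cst.
exact: cI.
Qed.

Let H2_deriv0 d : is_H2_deriv (fun=> 0) d ->
  {ae mu, forall t, D t -> d.1 t = 0} /\ {ae mu, forall t, D t -> d.2 t = 0}.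
Proof.
move=> [[s1 d1] h2]; have [s2 d2] := h2.
have int1 t : t \in `]0, pi[ -> \int[mu]_(s in `[0, t]) d.1 s = 0.
  move=> tp; have : D t by rewrite /D/=; exact: subset_itv_oo_cc.
  by move=> /d1; rewrite add0r => <-.
split; first exact: ac_deriv_cst int1.
apply: (ac_deriv_cst (k := - d.1 0)) => // t tp.
have Dt : D t by rewrite /D/=; exact: subset_itv_oo_cc.
apply/eqP; rewrite -addr_eq0 addrC -d2//; apply/eqP.
apply: (intD_cst (sqint_integrable s1) int1) => //.
apply: (@continuous_lebesgue_pt _ _ _ `]0, pi[%classic).
- by split; [exact: interval_open|].
- exact: measurable_itv.
- by apply: measurable_funS (s1.1) => //; exact: subset_itv_oo_cc.
have := ac_deriv_continuous h2.
move=> /(continuous_subspaceW (@subset_itv_oo_cc _ _ 0 pi)).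
by rewrite continuous_open_subspace; [apply; rewrite inE|exact: interval_open].
Qed.

Lemma H2_deriv_ae u d e : is_H2_deriv u d -> is_H2_deriv u e ->
  {ae mu, forall t, D t -> d.1 t = e.1 t} /\
  {ae mu, forall t, D t -> d.2 t = e.2 t}.
Proof.
move=> ud ue; have := H2_deriv_lin (-1) ue ud.
have -> : (fun t => -1 * u t + u t) = (fun=> 0) by apply/funext => t; ring.
move=> /H2_deriv0 /= [h1 h2].
by split; [apply: aeS h1|apply: aeS h2] => t /[apply] h; apply/eqP;
  rewrite -subr_eq0 -h mulN1r addrC.
Qed.

Lemma H2_normE u d : is_H2_deriv u d ->
  H2_norm u = Num.sqrt (l2prod u u + l2prod d.1 d.1 + l2prod d.2 d.2).
Proof.
move=> ud; rewrite /H2_norm.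
have /(xgetPex (fun=> 0, fun=> 0)) : exists d, is_H2_deriv u d by exists d.
rewrite -/(H2_deriv u) => ue; have [h1 h2] := H2_deriv_ae ue ud.
have [[s1 _] [s2 _]] := ud; have [[t1 _] [t2 _]] := ue.
by congr (Num.sqrt (_ + _ + _)); exact: l2prod_ae.
Qed.

Lemma H2D_fun_lin (k : R) u v : H2D_fun u -> H2D_fun v ->
  H2D_fun (fun t => k * u t + v t).
Proof.
move=> [su [d ud] u0 upi uN] [sv [e ve] v0 vpi vN]; split.
- exact: sqint_lin.
- by eexists; exact: H2_deriv_lin ud ve.
- by rewrite u0 v0 mulr0 addr0.
- by rewrite upi vpi mulr0 addr0.
- by move=> t tN; rewrite uN// vN// mulr0 addr0.
Qed.

Lemma H2D_fun0 : H2D_fun (fun=> 0).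
Proof.
have h : is_ac_deriv (fun=> 0 : R) (fun=> 0).
  split; first exact: sqint0.
  by move=> t _; rewrite add0r Rintegral_cst ?mul0r//; exact: measurable_itv.
split => //; first exact: sqint0.
by exists (fun=> 0, fun=> 0).
Qed.

Let pol_disc (A B C : R) : 0 <= A -> 0 <= C ->
  (forall x, 0 <= A * x ^+ 2 + 2 * B * x + C) -> B ^+ 2 <= A * C.
Proof.
move=> A0 C0 H; have [A_0|An0] := eqVneq A 0.
  have [->|Bn0] := eqVneq B 0; first by rewrite expr0n /= mulr_ge0.
  exfalso; have := H (- (C + 1) / (2 * B)).
  have -> : A * (- (C + 1) / (2 * B)) ^+ 2 + 2 * B * (- (C + 1) / (2 * B)) + C
     = -1 by rewrite A_0; field.
  by rewrite oppr_ge0 ler10.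
have Ap : 0 < A by rewrite lt_def An0.
have := H (- B / A).
have -> : A * (- B / A) ^+ 2 + 2 * B * (- B / A) + C = (A * C - B ^+ 2) / A.
  by field.
by rewrite pmulr_lge0 ?invr_gt0// subr_ge0.
Qed.

Lemma ler_H2_normD u v : H2D_fun u -> H2D_fun v ->
  H2_norm (fun t => u t + v t) <= H2_norm u + H2_norm v.
Proof.
move=> [su [d ud] _ _ _] [sv [e ve] _ _ _].
have [[d1 _] [d2 _]] := ud; have [[e1 _] [e2 _]] := ve.
pose A := l2prod u u + l2prod d.1 d.1 + l2prod d.2 d.2.
pose B := l2prod u v + l2prod d.1 e.1 + l2prod d.2 e.2.
pose C := l2prod v v + l2prod e.1 e.1 + l2prod e.2 e.2.
have expand (x : R) g h : sqint g -> sqint h ->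
    l2prod (fun t => x * g t + h t) (fun t => x * g t + h t) =
    l2prod g g * x ^+ 2 + 2 * l2prod g h * x + l2prod h h.
  move=> sg sh; have sgh := sqint_lin x sg sh.
  rewrite l2prod_linl// (l2prodC g) (l2prodC h) !l2prod_linl// (l2prodC h g).
  ring.
have nE x : H2_norm (fun t => x * u t + v t) =
    Num.sqrt (A * x ^+ 2 + 2 * B * x + C).
  rewrite (H2_normE (H2_deriv_lin x ud ve)) /= !expand// /A /B /C.
  by congr Num.sqrt; ring.
have pos x : 0 <= A * x ^+ 2 + 2 * B * x + C.
  have -> : A * x ^+ 2 + 2 * B * x + C =
    l2prod (fun t => x * u t + v t) (fun t => x * u t + v t) +
    l2prod (fun t => x * d.1 t + e.1 t) (fun t => x * d.1 t + e.1 t) +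
    l2prod (fun t => x * d.2 t + e.2 t) (fun t => x * d.2 t + e.2 t).
    by rewrite !expand// /A /B /C; ring.
  by rewrite !addr_ge0 ?l2prod_ge0.
have A0 : 0 <= A by rewrite !addr_ge0 ?l2prod_ge0.
have C0 : 0 <= C by rewrite !addr_ge0 ?l2prod_ge0.
have BAC := pol_disc A0 C0 pos.
rewrite (H2_normE ud) (H2_normE ve) -/A -/C.
under [X in H2_norm X]funext do rewrite -[X in X + _]mul1r.
rewrite nE expr1n !mulr1.
rewrite -(@ler_pXn2r _ 2) ?nnegrE ?addr_ge0 ?sqrtr_ge0//.
rewrite sqr_sqrtr; last by have := pos 1; rewrite expr1n !mulr1.
rewrite sqrrD !sqr_sqrtr// -sqrtrM// lerD2r lerD2l mulr2n mulrDl !mul1r.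
have : B <= Num.sqrt (A * C).
  by rewrite (le_trans (ler_norm _))// -sqrtr_sqr ler_wsqrtr.
by move=> h; exact: lerD.
Qed.

Lemma H2_normZ (k : R) u : H2D_fun u ->
  H2_norm (fun t => k * u t) = `|k| * H2_norm u.
Proof.
move=> [su [d ud] _ _ _].
have [[d1 _] [d2 _]] := ud.
have h0 : is_H2_deriv (fun=> 0) (fun=> 0 : R, fun=> 0 : R).
  have h : is_ac_deriv (fun=> 0 : R) (fun=> 0).
    split; first exact: sqint0.
    by move=> t _; rewrite add0r Rintegral_cst ?mul0r//; exact: measurable_itv.
  by split.
have E (g : R -> R) : (fun t => k * g t + 0) = (fun t => k * g t).
  by apply/funext => t; rewrite addr0.
have := H2_deriv_lin k ud h0; rewrite /= !E.
move=> /H2_normE -> /=; rewrite (H2_normE ud) -sqrtr_sqr -sqrtrM ?sqr_ge0//.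
have expand g : sqint g -> l2prod (fun t => k * g t) (fun t => k * g t)
    = k ^+ 2 * l2prod g g.
  move=> sg; have := sqint_lin k sg sqint0; rewrite E => sk.
  have l0 a : l2prod (fun=> 0) a = 0.
    rewrite /l2prod; under eq_Rintegral do rewrite mul0r.
    by rewrite Rintegral_cst ?mul0r.
  rewrite -[in l2prod _]E l2prod_linl//; last exact: sqint0.
  rewrite l0 addr0 (l2prodC g) -[in l2prod _ g]E l2prod_linl//; last exact: sqint0.
  by rewrite l0 addr0 mulrA -expr2.
by rewrite !expand// !mulrDr.
Qed.

Lemma H2_norm_eq0 u : H2D_fun u -> H2_norm u = 0 -> u = (fun=> 0).
Proof.
move=> [su [d ud] u0 _ uN]; rewrite (H2_normE ud).
have [[d1 ud1] [d2 _]] := ud.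
move=> /eqP; rewrite sqrtr_eq0 => h.
have /l2prod_eq0-/(_ d1) dz : l2prod d.1 d.1 = 0.
  by have := l2prod_ge0 u; have := l2prod_ge0 d.1; have := l2prod_ge0 d.2; lra.
apply/funext => t; have [tD|/uN//] := boolP (t \in `[0, pi]).
rewrite ud1// u0 add0r /Rintegral.
rewrite (ae_eq_integral (fun=> 0%E)) ?integral0//.
- have /measurable_int := sqint_integrable d1.
  by apply: measurable_funS => //; exact: subD.
by apply: aeS dz => x dx xt /=; rewrite dx//; exact: subD xt.
Qed.

End SquareIntegrable.

Section SobolevSpace.
Variable R : realType.
Local Notation mu := (@lebesgue_measure R).

Definition H2D_pred : {pred R -> R} := mem [set u | H2D_fun u].

Lemma H2D_submod_closed : submod_closed H2D_pred.
Proof.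
split; first by rewrite inE; exact: H2D_fun0.
by move=> k u v; rewrite !inE => hu hv; exact: H2D_fun_lin.
Qed.

HB.instance Definition _ :=
  GRing.isSubmodClosed.Build R (R -> R) H2D_pred H2D_submod_closed.

Record sobolevD := SobolevD {
  sobolevD_fun :> R -> R;
  sobolevD_funP : sobolevD_fun \in H2D_pred }.

HB.instance Definition _ := [isSub for sobolevD_fun].
HB.instance Definition _ := [Choice of sobolevD by <:].
HB.instance Definition _ := [SubChoice_isSubLmodule of sobolevD by <:].

Implicit Types (u v p : sobolevD).

Lemma sobolevDP u : H2D_fun u.
Proof. by have := sobolevD_funP u; rewrite inE. Qed.

Definition sobolevD_norm u : R := H2_norm u.

Lemma ler_sobolevD_normD u v :
  sobolevD_norm (u + v) <= sobolevD_norm u + sobolevD_norm v.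
Proof. exact: (ler_H2_normD (sobolevDP u) (sobolevDP v)). Qed.

Lemma sobolevD_normZ (k : R) u :
  sobolevD_norm (k *: u) = `|k| * sobolevD_norm u.
Proof. exact: (H2_normZ k (sobolevDP u)). Qed.

Lemma sobolevD_norm_eq0 u : sobolevD_norm u = 0 -> u = 0.
Proof. by move=> /(H2_norm_eq0 (sobolevDP u)) u0; exact/val_inj. Qed.

HB.instance Definition _ := Lmodule_isNormed.Build R sobolevD
  ler_sobolevD_normD sobolevD_normZ sobolevD_norm_eq0.

Lemma sobolevD_normE u : `|u| = H2_norm u. Proof. by []. Qed.

Lemma sqint_sobolevD u : sqint u. Proof. by case: (sobolevDP u). Qed.

Definition orth_pred p : {pred sobolevD} := [pred h : sobolevD | l2prod h p == 0].

Lemma orth_submod_closed p : submod_closed (orth_pred p).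
Proof.
have lin k u v : l2prod (k *: u + v) p = k * l2prod u p + l2prod v p.
  by apply: l2prod_linl; exact: sqint_sobolevD.
split=> [|k u v]; rewrite !inE.
  by have := lin (-1) 0 0; rewrite scaler0 addr0 mulN1r addNr => ->.
by move=> /eqP u0 /eqP v0; rewrite lin u0 v0 mulr0 addr0.
Qed.

HB.instance Definition _ p :=
  GRing.isSubmodClosed.Build R sobolevD (orth_pred p) (orth_submod_closed p).

Record orth p := Orth {
  orth_val :> sobolevD;
  orth_valP : orth_val \in orth_pred p }.

HB.instance Definition _ p := [isSub for @orth_val p].
HB.instance Definition _ p := [Choice of orth p by <:].
HB.instance Definition _ p := [SubChoice_isSubLmodule of orth p by <:].

Section OrthNorm.
Variable p : sobolevD.

Definition orth_norm (h : orth p) : R := `|orth_val h|.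

Lemma ler_orth_normD h1 h2 : orth_norm (h1 + h2) <= orth_norm h1 + orth_norm h2.
Proof. exact: ler_normD. Qed.

Lemma orth_normZ (k : R) h : orth_norm (k *: h) = `|k| * orth_norm h.
Proof. exact: (normrZ k (orth_val h)). Qed.

Lemma orth_norm_eq0 h : orth_norm h = 0 -> h = 0.
Proof. by move=> /normr0_eq0 h0; exact/val_inj. Qed.

HB.instance Definition _ := Lmodule_isNormed.Build R (orth p)
  ler_orth_normD orth_normZ orth_norm_eq0.

Lemma orth_normE (h : orth p) : `|h| = `|orth_val h|. Proof. by []. Qed.

End OrthNorm.

(* the coordinate along V = R p in the decomposition H + V *)
Definition orth_coord p u : R := l2prod u p / l2prod p p.

Lemma orth_proj_subproof p u : u - orth_coord p u *: p \in orth_pred p.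
Proof.
have sp := sqint_sobolevD p; have su := sqint_sobolevD u.
rewrite inE addrC -scaleNr.
have -> : l2prod (- orth_coord p u *: p + u) p =
    - orth_coord p u * l2prod p p + l2prod u p by exact: l2prod_linl.
have [p0|p0] := eqVneq (l2prod p p) 0; last first.
  by rewrite /orth_coord mulNr divfK// addNr.
rewrite p0 mulr0 add0r; apply/eqP.
have pz := l2prod_eq0 sp p0.
have s0 := @sqint0 R.
rewrite (l2prod_ae su sp su s0 _ pz); last by apply/nearW.
by rewrite /l2prod; under eq_Rintegral do rewrite mulr0; rewrite Rintegral_cst ?mul0r.
Qed.

Definition orth_proj p u : orth p := Orth (orth_proj_subproof p u).

Lemma orth_proj_decomp p u : u = orth_val (orth_proj p u) + orth_coord p u *: p.
Proof. by rewrite /= subrK. Qed.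

Lemma orth_proj_id p (h : orth p) : orth_proj p h = h.
Proof.
apply/val_inj => /=; rewrite /orth_coord.
by have := orth_valP h; rewrite inE => /eqP ->; rewrite mul0r scale0r subr0.
Qed.

End SobolevSpace.

Section Calculus.
Variables (R : realType) (V W : normedModType R).

(* [g] is C^1 on the open set [U]: it is differentiable at every point of [U] *)
(* and the differential is continuous on [U] for the operator norm.           *)
Definition C1_on (U : set V) (g : V -> W) : Prop :=
  forall x, U x -> differentiable g x /\
    forall e, 0 < e -> \forall y \near x,
      forall h, `|'d g y h - 'd g x h| <= e * `|h|.

(* C^1 on a subset: locally the restriction of a C^1 map on the ambient space *)
Definition C1_restr (M : set V) (g : V -> W) : Prop :=
  forall x, M x -> exists (U : set V) (G : V -> W),
    [/\ open U, U x, C1_on U G & forall y, U y -> M y -> G y = g y].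

End Calculus.

Section Submanifold.
Variables (R : realType) (V : normedModType R).

(* M is locally a regular level set of a real-valued C^1 function. *)
Definition C1_submanifold_codim1 (M : set V) : Prop :=
  forall x, M x -> exists (U : set V) (G : V -> R),
    [/\ open U, U x, C1_on U G,
        forall y, U y -> (M y <-> G y = 0)
      & forall y, U y -> M y -> exists h, 'd G y h != 0].

(* The restriction of [g] to the hypersurface [M] is a C^1 diffeomorphism onto*)
(* the whole of [W].  The inverse is C^1 into the embedded submanifold [M]    *)
(* exactly when it is C^1 into the ambient space.                             *)
Definition C1_diffeo_on (W : normedModType R) (M : set V) (g : V -> W) : Prop :=
  [/\ C1_submanifold_codim1 M, set_bij M setT g, C1_restr M g
    & exists s : W -> V,
      [/\ forall y, M (s y), cancel s g & C1_on setT s]].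

End Submanifold.

Section ArgumentFunction.
Variable R : realType.
Implicit Types (f v dv w : R -> R) (u : sobolevD R).
Let D : set R := `[0, pi].

Definition is_Cr (r : nat) f : Prop :=
  (forall k, (k < r)%N -> forall x, derivable (derive1n k f) x 1) /\
  continuous (derive1n r f).

(* [v] solves -v'' + f'(u) v = 0, v(0) = 0, v'(0) = 1 on [0, pi], and [dv] is *)
(* v'; as [v] and [dv] are continuous up to the endpoints, the derivatives    *)
(* there (one-sided) need not be mentioned.                                   *)
Definition is_ivp_sol f u v dv : Prop :=
  [/\ v 0 = 0, dv 0 = 1,
      {within D, continuous v}, {within D, continuous dv}
    & forall t, t \in `]0, pi[ ->
        is_derive t 1 v (dv t) /\ is_derive t 1 dv (derive1 f (u t) * v t)].

Definition is_argument v dv w : Prop :=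
  [/\ w 0 = 0, {within D, continuous w}
    & forall t, D t -> exists rho,
        [/\ 0 < rho, dv t = rho * cos (w t) & v t = rho * sin (w t)]].

(* W(u); its existence and its uniqueness on [0, pi] are classical *)
Definition argW f u : R -> R :=
  xget (fun=> 0) [set w | exists v dv, is_ivp_sol f u v dv /\ is_argument v dv w].

Definition M_ f (theta : R) : set (sobolevD R) := [set u | argW f u pi = theta].

Definition C_ f (j : nat) : set (sobolevD R) := M_ f (j%:R * pi).

End ArgumentFunction.

(* Main.v *)
(* Write (v', v) in polar coordinates (rho, th).  The angle solves the first  *)

(* The bridge to the statement is [argW_phase]: the argument at pi is the phase of q = f'(u).
   Regularity of the phase rests on one differential inequality, [gronwall]. It gives the quadratic
   expansion [phase_taylor], from which [dphase_lip] makes the differential Lipschitz in q. The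
   chain rule [phase_of_C1] carries this to X, because by [sobolevD_sup] the H^2 norm dominates the
   sup norm.

   Monotonicity is the sign of the differential ([dphase_lt0], [phase_lt]). As f'' has constant sign
   and p > 0, moving along p moves f'(u) in one direction on all of (0, pi), so no line u + R p
   meets a level set twice. Existence is the pair [ray_hits] and [phase_of_between]: the phases met
   on a line are those lying between the phases of two constants in the range of f', and this
   condition does not mention the line. So if one line meets M_theta, every line does. With
   [phase_const] the same pair decides when C_j is non-empty. The projection along p is thus a
   bijection from M_theta onto H, and [level_set_graph_C1] shows that its inverse is C^1, since the
   derivative along p never vanishes. *)
(* order Pruefer equation th' = 1 - (1 + q) sin(th)^2, q = f'(u), so that     *)
(* W(u)(pi) is the value [phase q] at pi of its solution.  Since q is bounded *)
(* the equation is globally Lipschitz in th, and the phase has a quadratic    *)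
(* Taylor estimate, uniform on bounded sets of q, with differential           *)
(*   k |-> - \int_0^pi E(t) sin(th(t))^2 k(t) dt,   E > 0.                    *)
(* Hence the phase decreases with q, and u |-> W(u)(pi) is C^1 on H^2 with    *)
(* nonzero derivative along p, strictly monotone on each line h + R p.        *)
(* On such a line f'(h + s p) tends to the bounds of f' on (0, pi) as s goes  *)
(* to +oo or -oo, so the phase takes there exactly the values lying between   *)
(* the phases of two constants in the range of f', whatever h is; as the      *)
(* constant -j^2 has phase j pi, this gives (1).  For (2) the level set is    *)
(* therefore a graph over H, which is C^1 by the implicit function argument.  *)
Require Import Defs.
From HB Require Import structures.
From mathcomp Require Import all_boot all_order all_algebra.
From mathcomp Require Import all_classical all_reals all_analysis.
From mathcomp Require Import ring lra.
Set Implicit Arguments.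
Unset Strict Implicit.
Unset Printing Implicit Defensive.
Import Order.TTheory GRing.Theory Num.Theory.
Import numFieldNormedType.Exports.
Local Open Scope classical_set_scope.
Local Open Scope ring_scope.

(** * Real calculus *)

Section RealCalculus.
Variable R : realType.
Implicit Types (f g F G : R -> R) (a b c t k : R).
Local Notation mu := (@lebesgue_measure R).

Lemma is_derive_add f g t a b : is_derive t 1 f a -> is_derive t 1 g b ->
  is_derive t 1 (fun s => f s + g s) (a + b).
Proof. by move=> df dg; exact: is_deriveD. Qed.

Lemma is_derive_opp f t a : is_derive t 1 f a ->
  is_derive t 1 (fun s => - f s) (- a).
Proof. by move=> df; exact: is_deriveN. Qed.

Lemma is_derive_sub f g t a b : is_derive t 1 f a -> is_derive t 1 g b ->
  is_derive t 1 (fun s => f s - g s) (a - b).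
Proof. by move=> df dg; exact: is_deriveB. Qed.

Lemma is_derive_mul f g t a b : is_derive t 1 f a -> is_derive t 1 g b ->
  is_derive t 1 (fun s => f s * g s) (f t * b + g t * a).
Proof. by move=> df dg; exact: is_deriveM. Qed.

Lemma is_derive_comp f g t a b : is_derive t 1 f a -> is_derive (f t) 1 g b ->
  is_derive t 1 (fun s => g (f s)) (b * a).
Proof. by move=> df dg; exact: is_derive1_comp. Qed.

Lemma continuous_add f g : continuous f -> continuous g ->
  continuous (fun s => f s + g s).
Proof. by move=> cf cg x; apply: cvgD; [exact: cf|exact: cg]. Qed.

Lemma continuous_opp f : continuous f -> continuous (fun s => - f s).
Proof. by move=> cf x; apply: cvgN; exact: cf. Qed.

Lemma continuous_mul f g : continuous f -> continuous g ->
  continuous (fun s => f s * g s).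
Proof. by move=> cf cg x; apply: cvgM; [exact: cf|exact: cg]. Qed.

Lemma continuous_fcomp f g : continuous f -> continuous g ->
  continuous (fun s => g (f s)).
Proof. by move=> cf cg x; apply: continuous_comp; [exact: cf|exact: cg]. Qed.

Lemma continuous_fid : continuous (fun s : R => s).
Proof. by move=> x; exact: cvg_id. Qed.

Lemma continuous_fcst (k : R) : continuous (fun _ : R => k).
Proof. by move=> x; exact: cvg_cst. Qed.

Lemma continuous_fmax f g : continuous f -> continuous g ->
  continuous (fun s => Num.max (f s) (g s)).
Proof. by move=> cf cg x; apply: (@continuous_max R R f g); [exact: cf|exact:
  cg]. Qed.

Lemma continuous_fmin f g : continuous f -> continuous g ->
  continuous (fun s => Num.min (f s) (g s)).
Proof. by move=> cf cg x; apply: (@continuous_min R R f g); [exact: cf|exact: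
  cg]. Qed.

Lemma continuous_fexp f : continuous f -> continuous (fun s => expR (f s)).
Proof. by move=> cf; apply: continuous_fcomp => //; exact: continuous_expR. Qed.

Lemma continuous_fsin f : continuous f -> continuous (fun s => sin (f s)).
Proof. by move=> cf; apply: continuous_fcomp => //; exact: continuous_sin. Qed.

Lemma continuous_fcos f : continuous f -> continuous (fun s => cos (f s)).
Proof. by move=> cf; apply: continuous_fcomp => //; exact: continuous_cos. Qed.

Lemma is_derive_cont f t a : is_derive t 1 f a -> {for t, continuous f}.
Proof. by case=> df _; apply: differentiable_continuous;
  exact/derivable1_diffP. Qed.

Lemma mvt_cont F F' a b : a < b -> continuous F ->
  (forall t, a < t < b -> is_derive t 1 F (F' t)) ->
  exists2 c, a < c < b & F b - F a = F' c * (b - a).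
Proof.
move=> ab cF dF; have dF' x : x \in `]a, b[ -> is_derive x 1 F (F' x).
  by rewrite in_itv /= => /dF.
have [c] := MVT ab dF' (continuous_subspaceT cF).
by rewrite in_itv /= => cab; exists c.
Qed.

Lemma derive_ge0_le F F' a b : a <= b -> continuous F ->
  (forall t, a < t < b -> is_derive t 1 F (F' t)) ->
  (forall t, a < t < b -> 0 <= F' t) -> F a <= F b.
Proof.
rewrite le_eqVlt => /predU1P[->//|ab] cF dF F0.
have [c cab Fba] := mvt_cont ab cF dF.
by rewrite -subr_ge0 Fba mulr_ge0 ?F0 ?subr_ge0 // ltW.
Qed.

Lemma derive_le0_ge F F' a b : a <= b -> continuous F ->
  (forall t, a < t < b -> is_derive t 1 F (F' t)) ->
  (forall t, a < t < b -> F' t <= 0) -> F b <= F a.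
Proof.
rewrite le_eqVlt => /predU1P[->//|ab] cF dF F0.
have [c cab Fba] := mvt_cont ab cF dF.
by rewrite -subr_le0 Fba mulr_le0_ge0 ?F0 ?subr_ge0 // ltW.
Qed.

Lemma derive_0_eq F F' a b : a <= b -> continuous F ->
  (forall t, a < t < b -> is_derive t 1 F (F' t)) ->
  (forall t, a < t < b -> F' t = 0) -> F a = F b.
Proof.
rewrite le_eqVlt => /predU1P[->//|ab] cF dF F0.
have [c cab Fba] := mvt_cont ab cF dF.
by apply/eqP; rewrite eq_sym -subr_eq0 Fba F0// mul0r.
Qed.

Lemma continuous_bounded_itv f (a b : R) : continuous f ->
  exists2 K, 0 <= K & forall t, a <= t <= b -> `|f t| <= K.
Proof.
move=> cf; have [ab|ba] := leP a b; last first.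
  by exists 0 => // t /andP[/le_trans h /h]; rewrite leNgt ba.
have cnf : continuous (fun t => `|f t|).
  by move=> t; apply: (@continuous_comp _ _ _ f Num.norm);
    [exact: cf|exact: norm_continuous].
have [c _ cmax] := EVT_max ab (continuous_subspaceT cnf).
by exists `|f c| => // t tab; apply: cmax; rewrite in_itv.
Qed.

(* Extended by 0 to t <= 0: all functions below are then continuous on the    *)
(* whole line and are differentiated only at t > 0.                           *)
Definition prim f t : R := \int[mu]_(s in `[0, Num.max t 0]) f s.

Lemma continuous_integrable f (a b : R) : continuous f ->
  mu.-integrable `[a, b] (EFin \o f).
Proof.
move=> cf; apply: continuous_compact_integrable; first exact: segment_compact.
exact: continuous_subspaceT.
Qed.

Lemma prim_le0 f t : t <= 0 -> prim f t = 0.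
Proof.
move=> t0; rewrite /prim max_r// set_itv1.
by rewrite /Rintegral integral_set1.
Qed.

Lemma is_derive_prim f t : continuous f -> 0 < t -> is_derive t 1 (prim f) (f t).
Proof.
move=> cf t0; have tt1 : t < t + 1 by rewrite ltrDl.
have [dF FE] := @continuous_FTC1 R f (BLeft 0) t (t + 1) tt1
  (continuous_integrable 0 (t + 1) cf) t0 (cf t).
have E : \forall y \near t, prim f y = \int[mu]_(s in `[0, y]) f s.
  near=> y; rewrite /prim max_l//; near: y.
  by apply: filterS (lt_nbhsr t0) => y /ltW.
apply: (@near_eq_is_derive R R R (fun y => \int[mu]_(s in `[0, y]) f s) _ t 1).
  by apply: filterS E => y ->.
by rewrite -FE derive1E; exact/derivableP.
Unshelve. all: by end_near. Qed.

(** The retraction of the line onto [a, b] is continuous with values in [a, b], so only the relative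
    neighbourhoods of [a, b] are ever consulted. *)
Lemma continuous_clamp F (a b : R) : a <= b -> {within `[a, b], continuous F} ->
  continuous (fun t => F (Num.max a (Num.min t b))).
Proof.
move=> ab cF t; set c := fun t => Num.max a (Num.min t b).
have cab x : c x \in `[a, b].
  by rewrite in_itv /= /c le_max lexx /= ge_max ab ge_min lexx orbT.
have cc : c x @[x --> t] --> c t.
  apply: (@continuous_fmax (fun=> a) (fun t => Num.min t b)).
    exact: continuous_fcst.
  by apply: continuous_fmin; [exact: continuous_fid|exact: continuous_fcst].
have cct : [set` `[a, b]] (c t) by exact: cab.
move=> B FB.
have : @nbhs_subspace R `[a, b]%classic (c t) (F @^-1` B) := cF (c t) B FB.
rewrite -(nbhs_subspace_in cct) => W.
have W' : \forall x \near t, [set` `[a, b]] (c x) -> B (F (c x)) := cc _ W.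
change (\forall x \near t, B (F (c x))).
by apply: filterS W' => x; apply; exact: cab.
Qed.

(** The parametrised integral is continuous on a compact interval; near t the primitive agrees with
    its clamped version on [0, |t| + 1]. *)
Lemma prim_continuous f : continuous f -> continuous (prim f).
Proof.
move=> cf t; have t1 : 0 <= `|t| + 1 by rewrite addr_ge0.
have := continuous_clamp t1 (parameterized_integral_continuous t1
  (continuous_integrable 0 (`|t| + 1) cf)).
move=> /(_ t); rewrite /continuous_at /parameterized_integral.
have e x : x <= `|t| + 1 -> \int[mu]_(s in `[0,
  Num.max 0 (Num.min x (`|t| + 1))]) f s = prim f x.
  by move=> xt; rewrite /prim min_l// maxC.
rewrite e; last by rewrite (le_trans (ler_norm _))// lerDl.
apply: cvg_trans; apply: near_eq_cvg; near=> x; rewrite e//; near: x.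
have tt1 : t < `|t| + 1 by rewrite (le_lt_trans (ler_norm _))// ltrDl.
by apply: filterS (lt_nbhsl tt1) => y /ltW.
Unshelve. all: by end_near. Qed.

Lemma prim_unique f F t : continuous f -> continuous F -> 0 <= t ->
  (forall s, 0 < s < t -> is_derive s 1 F (f s)) -> F t = F 0 + prim f t.
Proof.
move=> cf cF t0 dF.
have cP := prim_continuous cf.
suff : F 0 - prim f 0 = F t - prim f t.
  by rewrite (@prim_le0 _ 0)// subr0 => ->; rewrite subrK.
apply: (@derive_0_eq (fun s => F s - prim f s) (fun=> 0) 0 t t0) => //.
  by move=> x; apply: cvgB; [exact: cF|exact: cP].
move=> s /andP[s0 st]; rewrite -(subrr (f s)); apply: is_derive_sub.
  by apply: dF; rewrite s0.
exact: is_derive_prim.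
Qed.

Lemma primD f g k t : continuous f -> continuous g -> 0 <= t ->
  prim (fun s => k * f s + g s) t = k * prim f t + prim g t.
Proof.
move=> cf cg t0.
have ckf : continuous (fun s => k * f s + g s).
  by move=> x; apply: cvgD; [apply: cvgMr; exact: cf|exact: cg].
rewrite -[LHS]add0r.
have {1}-> : 0 = k * prim f 0 + prim g 0 by rewrite !prim_le0// mulr0 addr0.
apply/esym; apply: (@prim_unique _ (fun s => k * prim f s + prim g s)) => //.
  apply: continuous_add; last exact: prim_continuous.
  apply: continuous_mul; [exact: continuous_fcst|exact: prim_continuous].
move=> s /andP[s0 _]; apply: is_derive_add; last exact: is_derive_prim.
have := is_derive_mul (is_derive_cst k s 1) (is_derive_prim cf s0).
by rewrite mulr0 addr0.
Qed.

Lemma prim_ge0 f t : continuous f -> (forall s, 0 < s < t -> 0 <= f s) ->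
  0 <= prim f t.
Proof.
move=> cf f0; have [t0|/ltW t0] := leP t 0; first by rewrite prim_le0.
rewrite -(@prim_le0 f 0)//; apply: (@derive_ge0_le _ f) => //.
  exact: prim_continuous.
by move=> s /andP[s0 _]; exact: is_derive_prim.
Qed.

Lemma le_prim f g t : continuous f -> continuous g ->
  (forall s, 0 < s < t -> f s <= g s) -> prim f t <= prim g t.
Proof.
move=> cf cg fg; have [t0|/ltW t0] := leP t 0; first by rewrite !prim_le0.
have := primD (-1) cf cg t0; rewrite mulN1r addrC => e.
rewrite -subr_ge0 -e; apply: prim_ge0 => [x|s /fg];
  last by rewrite mulN1r addrC subr_ge0.
by apply: cvgD; [apply: cvgMr; exact: cf|exact: cg].
Qed.

(** If the primitive vanished at t, being nondecreasing it would vanish on all of (0, t), and so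
    would its derivative at c, which is [f c]. *)
Lemma prim_gt0 f t c : continuous f -> (forall s, 0 < s < t -> 0 <= f s) ->
  0 < c < t -> 0 < f c -> 0 < prim f t.
Proof.
move=> cf f0 /andP[c0 ct] fc.
rewrite lt_neqAle prim_ge0// andbT eq_sym; apply/eqP => P0.
have Pz s : 0 < s < t -> prim f s = 0.
  move=> /andP[s0 st]; apply/eqP; rewrite eq_le prim_ge0 ?andbT//; last first.
    by move=> x /andP[x0 xs]; apply: f0; rewrite x0 (lt_trans xs).
  rewrite -P0; apply: (@derive_ge0_le _ f) => [||x /andP[sx _]|x /andP[sx xt]].
  - exact: ltW.
  - exact: prim_continuous.
  - by apply: is_derive_prim => //; rewrite (lt_trans s0).
  - by apply: f0; rewrite xt (lt_trans s0).
have d1 := is_derive_prim cf c0.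
have d2 : is_derive c 1 (prim f) 0.
  apply: (@near_eq_is_derive R R R (cst 0)).
  near=> y; rewrite /= Pz//; apply/andP; split; near: y; [exact: lt_nbhsr|exact:
    lt_nbhsl].
have := @derive_val _ _ _ _ _ _ _ d1; rewrite (@derive_val _ _ _ _ _ _ _ d2) => f0'.
by rewrite -f0' ltxx in fc.
Unshelve. all: by end_near. Qed.

(* The square of [y] satisfies a linear differential inequality, so no        *)
(* regularisation of [|y|] is needed.                                         *)
Lemma gronwall (L l : R) : 0 <= L -> exists2 G, 0 <= G &
  forall (y y' : R -> R) (a b e : R), 0 <= e -> a <= b -> b - a <= l ->
    continuous y ->
  (forall t, a < t < b -> is_derive t 1 y (y' t)) ->
  (forall t, a < t < b -> `|y' t| <= L * `|y t| + e) ->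
  `|y b| <= G * (`|y a| + e).
Proof.
move=> L0; pose m := 2 * L + 1; pose M := expR (m * l) * (1 + l ^+ 2).
(* The estimate reached is y(b)^2 <= M (|y(a)| + e)^2; using M <= (1 + M)^2 avoids a square root. *)
exists (1 + M); first by rewrite addr_ge0// mulr_ge0 ?expR_ge0// addr_ge0// sqr_ge0.
move=> y y' a b e e0 ab bal cy dy y'le.
(* The rate m = 2 L + 1 absorbs 2 L y^2 and, through 2 |y| e <= y^2 + e^2, the cross term; what
   remains is at most e^2, so z is nonincreasing. *)
pose z t := expR (- (m * (t - a))) * y t ^+ 2 - e ^+ 2 * (t - a).
pose z' t := expR (- (m * (t - a))) * (2 * y t * y' t - m * y t ^+ 2) - e ^+ 2.
have clin k : continuous (fun t => k * (t - a)).
  apply: continuous_mul; first exact: continuous_fcst.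
  by apply: continuous_add; [exact: continuous_fid|exact: continuous_fcst].
have cz : continuous z.
  apply: continuous_add; last by apply: continuous_opp; exact: clin.
  apply: continuous_mul; last by apply: continuous_mul.
  by apply: continuous_fexp; apply: continuous_opp; exact: clin.
have dlin k t : is_derive t 1 (fun s => k * (s - a)) k.
  have := is_derive_mul (is_derive_cst k t 1)
    (is_derive_sub (is_derive_id t 1) (is_derive_cst a t 1)).
  by rewrite subr0 mulr1 mulr0 addr0.
have dz t : a < t < b -> is_derive t 1 z (z' t).
  move=> /dy dyt.
  have d1 := is_derive_comp (is_derive_opp (dlin m t)) (is_derive_expR _).
  have d2 := is_derive_mul d1 (is_derive_mul dyt dyt).
  apply: is_derive_eq (is_derive_sub d2 (dlin (e ^+ 2) t)) _.
  by rewrite /z'; ring.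
have z'0 t : a < t < b -> z' t <= 0.
  move=> tab; rewrite /z' subr_le0.
  have E1 : expR (- (m * (t - a))) <= 1.
    rewrite -expR0 ler_expR oppr_le0 mulr_ge0 ?subr_ge0//.
      by rewrite /m addr_ge0// mulr_ge0.
    by case/andP: tab => /ltW.
  have B : 2 * y t * y' t - m * y t ^+ 2 <= e ^+ 2.
    have := y'le _ tab => h.
    have : y t * y' t <= `|y t| * (L * `|y t| + e).
      by rewrite (le_trans (ler_norm _))// normrM ler_wpM2l.
    rewrite -(real_normK (num_real (y t))) /m.
    have : 0 <= (`|y t| - e) ^+ 2 by rewrite sqr_ge0.
    rewrite -mulrA; move: (`|y t|) (y t * y' t) => Y Z; nra.
  rewrite (le_trans (ler_wpM2l (expR_ge0 _) B))//.
  by rewrite ler_piMl// sqr_ge0.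
have zba : z b <= z a by exact: (derive_le0_ge ab cz dz z'0).
have l0 : 0 <= l by rewrite (le_trans _ bal)// subr_ge0.
have M0 : 0 <= M by rewrite mulr_ge0 ?expR_ge0// addr_ge0// sqr_ge0.
have d0 : 0 <= b - a by rewrite subr_ge0.
have m0 : 0 <= m by rewrite /m addr_ge0// mulr_ge0.
have Em : expR (m * (b - a)) <= expR (m * l) by rewrite ler_expR ler_wpM2l.
move: zba; rewrite /z (subrr a) !mulr0 oppr0 expR0 mul1r addr0.
rewrite lerBlDr -(@ler_pM2l _ (expR (m * (b - a)))) ?expR_gt0//
  mulrA -expRD subrr expR0 mul1r => zba.
rewrite -(@ler_pXn2r _ 2) ?nnegrE ?mulr_ge0 ?addr_ge0//.
rewrite real_normK ?num_real// (le_trans zba)//.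
have A0 : 0 <= `|y a| by [].
have h1 : y a ^+ 2 + e ^+ 2 * (b - a) <= (1 + l ^+ 2) * (`|y a| + e) ^+ 2.
  rewrite -(real_normK (num_real (y a))).
  have dl : b - a <= 1 + l ^+ 2 by have := sqr_ge0 (l - 1); have := sqr_ge0 l; lra.
  have := ler_wpM2l (sqr_ge0 e) dl.
  have : 0 <= `|y a| * e by rewrite mulr_ge0.
  have : 0 <= l ^+ 2 * (`|y a| * e) by rewrite mulr_ge0 ?sqr_ge0// mulr_ge0.
  have : 0 <= l ^+ 2 * (`|y a| ^+ 2) by rewrite mulr_ge0 ?sqr_ge0.
  by move: (`|y a|) => A; lra.
have h0 : 0 <= y a ^+ 2 + e ^+ 2 * (b - a) by rewrite addr_ge0 ?sqr_ge0//
  mulr_ge0// sqr_ge0.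
apply: (@le_trans _ _ (M * (`|y a| + e) ^+ 2)).
  by rewrite /M -mulrA; apply: ler_pM => //; exact: expR_ge0.
rewrite exprMn ler_wpM2r ?sqr_ge0//.
by have := sqr_ge0 M; lra.
Qed.

End RealCalculus.

Ltac continuity := match goal with
  | |- continuous (fun s => ?k) => exact (@continuous_fcst _ k)
  | H : continuous ?f |- continuous ?f => exact H
  | H : continuous ?f |- continuous (fun s => ?f s) => exact H
  | |- continuous (fun s => @?f s *+ 2) => refine (@continuous_add _ f f _ _);
    continuity
  | |- continuous (fun s => s) => exact (@continuous_fid _)
  | |- continuous (fun s => @?f s + @?g s) => refine (@continuous_add _ f g _ _);
    continuity
  | |- continuous (fun s => - @?f s) => refine (@continuous_opp _ f _); continuity
  | |- continuous (fun s => @?f s * @?g s) => refine (@continuous_mul _ f g _ _);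
    continuity
  | |- continuous (fun s => @?f s ^+ 2) => refine (@continuous_mul _ f f _ _);
    continuity
  | |- continuous (fun s => Num.max (@?f s) (@?g s)) =>
    refine (@continuous_fmax _ f g _ _); continuity
  | |- continuous (fun s => Num.min (@?f s) (@?g s)) =>
    refine (@continuous_fmin _ f g _ _); continuity
  | |- continuous (fun s => expR (@?f s)) => refine (@continuous_fexp _ f _);
    continuity
  | |- continuous (fun s => sin (@?f s)) => refine (@continuous_fsin _ f _);
    continuity
  | |- continuous (fun s => cos (@?f s)) => refine (@continuous_fcos _ f _);
    continuity
  | |- continuous (prim ?f) => refine (@prim_continuous _ f _); continuity
  | |- _ => idtac
  end.

(** * The Pruefer equation *)

Section Picard.
Variable R : realType.
Implicit Types (f g F q : R -> R) (a b c t x y k : R).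

Lemma lip_derive F F' k x y : (forall t, is_derive t 1 F (F' t)) ->
  (forall t, `|F' t| <= k) -> `|F x - F y| <= k * `|x - y|.
Proof.
move=> dF F'k; have cF : continuous F.
  by move=> t; exact: (is_derive_cont (dF t)).
wlog xy : x y / x <= y.
  move=> h; case: (leP x y) => [/h//|/ltW/h].
  by rewrite (distrC y) (distrC (F y)).
move: xy; rewrite le_eqVlt => /predU1P[->|xy]; first by rewrite !subrr normr0 mulr0.
have [c _ e] := mvt_cont xy cF (fun t _ => dF t).
by rewrite distrC e normrM (distrC x) ler_wpM2r.
Qed.

Lemma is_derive_sin2 x : is_derive x 1 (fun x => sin x ^+ 2) (sin (x *+ 2)).
Proof.
have := is_derive_mul (is_derive_sin x) (is_derive_sin x).
move=> h; apply: is_derive_eq h _.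
by rewrite sin_mulr2n (mulrC (cos x)) mulr2n.
Qed.

Lemma sin2_lip x y : `|sin x ^+ 2 - sin y ^+ 2| <= `|x - y|.
Proof.
rewrite -[leRHS]mul1r; apply: (lip_derive _ _ is_derive_sin2) => t.
exact: sin_max.
Qed.

Lemma sin_lip x y : `|sin x - sin y| <= `|x - y|.
Proof.
rewrite -[leRHS]mul1r; apply: (lip_derive _ _ (@is_derive_sin R)) => t.
exact: cos_max.
Qed.

(** As 2^n > n, the archimedean property brings c / 2^n below any positive x - y. *)
Lemma geom_squeeze x y c : (forall n, x <= y + c / 2 ^+ n) -> x <= y.
Proof.
move=> h; rewrite leNgt; apply/negP => yx.
have d0 : 0 < x - y by rewrite subr_gt0.
have [n] : exists n : nat, c / (x - y) < n%:R.
  exists (Num.bound `|c / (x - y)|).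
  by rewrite (le_lt_trans (ler_norm _))// (archi_boundP (normr_ge0 _)).
rewrite ltr_pdivrMr// => cn.
have := h n; rewrite -lerBlDl leNgt ltr_pdivrMr ?exprn_gt0// => /negP; apply.
apply: lt_le_trans cn _; rewrite mulrC ler_wpM2l ?ltW//.
by rewrite -natrX ltr_nat ltn_expl.
Qed.

(** The intervals of radius 2 c / 2^n around [u n] are nested, since this radius is c / 2^n plus the
    next radius. The limit is the supremum of their left ends. *)
Lemma geom_limit (u : nat -> R) c :
  (forall n, `|u n.+1 - u n| <= c / 2 ^+ n) ->
  exists l, forall n, `|l - u n| <= 2 * c / 2 ^+ n.
Proof.
move=> uc; pose lo n := u n - 2 * c / 2 ^+ n; pose hi n := u n + 2 * c / 2 ^+ n.
have e n : 2 * c / 2 ^+ n = c / 2 ^+ n + 2 * c / 2 ^+ n.+1.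
  by rewrite exprS; field; rewrite expf_neq0.
have c0 : 0 <= c by have := le_trans (normr_ge0 _) (uc 0); rewrite expr0 divr1.
have lo1 n : lo n <= lo n.+1.
  by have := uc n; rewrite ler_norml /lo (e n) => /andP[]; lra.
have hi1 n : hi n.+1 <= hi n.
  by have := uc n; rewrite ler_norml /hi (e n) => /andP[]; lra.
have loM : {homo lo : m n / (m <= n)%N >-> m <= n} by apply/nondecreasing_seqP.
have hiM m n : (m <= n)%N -> hi n <= hi m by move: m n; apply/nonincreasing_seqP.
have lohi m n : lo m <= hi n.
  apply: (le_trans (loM _ _ (leq_maxl m n))); apply:
    (le_trans _ (hiM _ _ (leq_maxr m n))).
  rewrite /lo /hi; have : 0 <= 2 * c / 2 ^+ maxn m n by rewrite divr_ge0
    ?mulr_ge0// exprn_ge0.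
  lra.
exists (sup (range lo)) => n.
have h1 : lo n <= sup (range lo).
  by apply: ub_le_sup; [exists (hi 0) => _ [m _ <-]|exists n].
have h2 : sup (range lo) <= hi n.
  by apply: ge_sup; [exists (lo 0); exists 0|move=> _ [m _ <-]].
by rewrite ler_norml; move: h1 h2; rewrite /lo /hi => h1 h2; apply/andP; split; lra.
Qed.

Lemma norm_prim_le f g t : continuous f -> continuous g ->
  (forall s, 0 < s < t -> `|f s| <= g s) -> `|prim f t| <= prim g t.
Proof.
move=> cf cg fg; have [t0|/ltW t0] := leP t 0; first by rewrite !prim_le0// normr0.
rewrite ler_norml le_prim// ?andbT; last by move=> s /fg; rewrite ler_norml =>
  /andP[].
have -> : - prim g t = prim (fun s => - g s) t.
  have := primD (-1) cg (@continuous_fcst R 0) t0.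
  under eq_fun do rewrite mulN1r addr0; move=> ->.
  have : prim (fun=> 0 : R) t = 0.
    have := primD (-1) (@continuous_fcst R 0) (@continuous_fcst R 0) t0.
    by under eq_fun do rewrite mulN1r addr0 oppr0; rewrite mulN1r addNr.
  by move=> ->; rewrite mulN1r addr0.
apply: le_prim => //; first exact: continuous_opp.
by move=> s /fg; rewrite ler_norml => /andP[].
Qed.

Lemma prim_lip f b s t : continuous f -> (forall s, `|f s| <= b) ->
  `|prim f t - prim f s| <= b * `|t - s|.
Proof.
move=> cf fb; have b0 : 0 <= b by apply: le_trans (fb 0).
have cp := prim_continuous cf.
wlog st : s t / s <= t.
  move=> h; case: (leP s t) => [/h//|/ltW/h].
  by rewrite (distrC s) (distrC (prim f s)).
have pos s' t' : 0 <= s' -> s' <= t' -> `|prim f t' - prim f s'| <= b * `|t' - s'|.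
  move=> s0; rewrite le_eqVlt => /predU1P[->|st'];
    first by rewrite !subrr normr0 mulr0.
  have [|c _ ->] := @mvt_cont R _ f _ _ st' cp; last by rewrite normrM ler_wpM2r.
  by move=> x /andP[sx _]; apply: is_derive_prim => //; exact: le_lt_trans sx.
have [s0|s0] := leP 0 s; first exact: pos.
have [t0|t0] := leP 0 t.
  rewrite (@prim_le0 _ _ s)//; last exact: ltW.
  rewrite -(@prim_le0 _ f 0)//; apply: (le_trans (pos _ _ (lexx 0) t0));
    rewrite ler_wpM2l// subr0.
  by rewrite !ger0_norm ?subr_ge0//; lra.
by rewrite !prim_le0 ?subrr ?normr0 ?mulr_ge0// ltW.
Qed.

(** Equal to cos(th)^2 - q sin(th)^2, the angular speed of (v', v) when v'' = q v. *)
Definition pruefer_field q (th : R -> R) t := 1 - (1 + q t) * sin (th t) ^+ 2.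

Lemma pruefer_field_continuous q th : continuous q -> continuous th ->
  continuous (pruefer_field q th).
Proof.
move=> cq ct; apply: continuous_add; first exact: continuous_fcst.
apply/continuous_opp/continuous_mul; last by apply: continuous_mul; exact:
  continuous_fsin.
by apply: continuous_add => //; exact: continuous_fcst.
Qed.

Section Iteration.
Variables (q : R -> R) (K : R).
Hypothesis qc : continuous q.
Hypothesis qK : forall t, `|q t| <= K.

Let K0 : 0 <= K. Proof. exact: le_trans (qK 0). Qed.
Let L := 1 + K.

(* The Picard iterates satisfy |th n.+1 - th n| <= e / 2 ^+ n for the weight  *)
(* e t = exp(2 L t), L a Lipschitz constant.                                  *)
Let th n := iter n (fun u => prim (pruefer_field q u)) (fun=> 0 : R).

Let thc n : continuous (th n).
Proof.
elim: n => [|n IH]; first exact: continuous_fcst.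
by rewrite /th iterS; apply: prim_continuous; exact: pruefer_field_continuous.
Qed.

Let fieldc n : continuous (pruefer_field q (th n)).
Proof. exact: pruefer_field_continuous. Qed.

Let q1 t : `|1 + q t| <= L.
Proof. by rewrite (le_trans (ler_normD _ _))// normr1 lerD2l. Qed.

Let field_lip u v t : `|pruefer_field q u t - pruefer_field q v t| <= L * `|u t - v
  t|.
Proof.
have -> : pruefer_field q u t - pruefer_field q v t =
   (1 + q t) * (sin (v t) ^+ 2 - sin (u t) ^+ 2) by rewrite /pruefer_field; ring.
by rewrite normrM ler_pM// distrC sin2_lip.
Qed.

Let field_bound u t : `|pruefer_field q u t| <= 1 + L.
Proof.
rewrite (le_trans (ler_normB _ _))// normr1 lerD2l normrM -[leRHS]mulr1.
by apply: ler_pM => //; rewrite normrX exprn_ile1// sin_max.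
Qed.

Let e t := expR (2 * L * t).

Let ec k : continuous (fun t => k * (2 * L * e t)).
Proof.
apply: continuous_mul; first exact: continuous_fcst.
apply: continuous_mul; first exact: continuous_fcst.
apply: continuous_fexp; apply: continuous_mul; first exact: continuous_fcst.
exact: continuous_fid.
Qed.

Let prim_e k t : 0 <= t -> prim (fun s => k * (2 * L * e s)) t = k * (e t - 1).
Proof.
move=> t0; have cke : continuous (fun t => k * e t).
  apply: continuous_mul; first exact: continuous_fcst.
  apply: continuous_fexp; apply: continuous_mul; first exact: continuous_fcst.
  exact: continuous_fid.
have d s : 0 < s < t -> is_derive s 1 (fun t => k * e t) (k * (2 * L * e s)).
  move=> _; have d1 := is_derive_mul (is_derive_cst (2 * L) s 1) (is_derive_id s 1).
  have d2 := is_derive_mul (is_derive_cst k s 1) (is_derive_comp d1 (is_derive_expR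
    _)).
  by apply: is_derive_eq d2 _; rewrite /e /cst; ring.
have := prim_unique (@ec k) cke t0 d.
have -> : e 0 = 1 by rewrite /e mulr0 expR0.
by move=> h; rewrite mulrBr mulr1 h; ring.
Qed.

Let L1 : 1 <= L. Proof. by rewrite /L lerDl. Qed.

Let e1 t : 0 <= t -> 1 <= e t.
Proof. by move=> t0; rewrite -expR0 ler_expR !mulr_ge0//; apply: le_trans L1. Qed.

(** The Lipschitz constant turns e / 2^n into L e / 2^n = 2 L e / 2^(n+1), whose primitive is (e -
    1) / 2^(n+1): the factor 2 in the exponent of the weight produces the halving. *)
Let step n t : 0 <= t -> `|th n.+1 t - th n t| <= e t / 2 ^+ n.
Proof.
elim: n t => [|n IH] t t0.
  rewrite subr0 expr0 divr1.
  apply: (@le_trans _ _ (prim (fun s => 1 * (2 * L * e s)) t)).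
    apply: norm_prim_le => [||s /andP[/ltW s0 _]]; [exact: fieldc 0%N|exact: ec|].
    rewrite /pruefer_field /= sin0 expr0n /= mulr0 subr0 normr1 mul1r.
    by have := e1 s0; have := L1; nra.
  by rewrite prim_e// mul1r gerBl.
have -> : th n.+2 t - th n.+1 t =
    prim (fun s => (-1) * pruefer_field q (th n) s + pruefer_field q (th n.+1) s) t.
  rewrite (primD (-1) (@fieldc n) (@fieldc n.+1) t0) mulN1r addrC; exact: erefl.
apply: (@le_trans _ _ (prim (fun s => (2 ^+ n.+1)^-1 * (2 * L * e s)) t)).
  apply: norm_prim_le => //.
    apply: continuous_add => //; apply: continuous_mul => //; exact:
      continuous_fcst.
  move=> s /andP[/ltW s0 _]; rewrite mulN1r addrC (le_trans (field_lip _ _ _))//.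
  have := IH s s0; rewrite -(@ler_pM2l _ L); last exact: lt_le_trans L1.
  by move=> /le_trans; apply; rewrite exprS; rewrite le_eqVlt; apply/orP; left;
    apply/eqP; field; rewrite expf_neq0.
rewrite prim_e// mulrC ler_wpM2r ?invr_ge0 ?exprn_ge0//; lra.
Qed.

(** The iterates share the Lipschitz constant 1 + L, hence so does their pointwise limit, which is
    therefore continuous. Comparing the next iterate with the primitive of the field at the limit
    gives the integral equation. *)
Lemma pruefer_exists : exists u : R -> R, [/\ continuous u, u 0 = 0 &
  forall t, 0 < t -> is_derive t 1 u (pruefer_field q u t)].
Proof.
(* For t <= 0 every iterate is 0, so the bound at max(t, 0) covers the whole line. *)
have : forall t, exists l, forall n, `|l - th n t| <= 2 * e (Num.max t 0) / 2 ^+ n.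
  move=> t; apply: geom_limit => n; have [t0|t0] := leP 0 t; first exact: step.
  have {}t0 := ltW t0.
  have th0 m : th m t = 0 by case: m => // m; exact: prim_le0.
  by rewrite !th0 subrr normr0 divr_ge0 ?expR_ge0// exprn_ge0.
move=> /choice[u ul].
have lim0 x y c : (forall n, `|x - y| <= c / 2 ^+ n) -> x = y.
  move=> h; apply/eqP; rewrite -subr_eq0 -normr_eq0 eq_le normr_ge0 andbT.
  by apply: (@geom_squeeze _ _ c) => n; rewrite add0r.
have ulip s t : `|u t - u s| <= (1 + L) * `|t - s|.
  apply: (@geom_squeeze _ _ (2 * e (Num.max t 0) + 2 * e (Num.max s 0))) => n.
  have := ul t n; have := ul s n.
  have : `|th n t - th n s| <= (1 + L) * `|t - s|.
    case: n => [|n]; first by rewrite subrr normr0 mulr_ge0// addr_ge0//; apply: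
      le_trans L1.
    by apply: prim_lip => //; exact: field_bound.
  rewrite mulrDl.
  have -> : u t - u s = (u t - th n t) + (th n t - th n s) - (u s - th n s) by ring.
  have := ler_normB (u t - th n t + (th n t - th n s)) (u s - th n s).
  have := ler_normD (u t - th n t) (th n t - th n s).
  lra.
have uc : continuous u.
  move=> t; apply/cvgrPdist_lt => eps eps0.
  have L2 : 0 < 1 + L by rewrite addr_gt0//; apply: lt_le_trans L1.
  have := @nbhsx_ballx _ _ t _ (divr_gt0 eps0 L2).
  apply: filterS => s; rewrite /ball /= ltr_pdivlMr// mulrC => ts.
  exact: le_lt_trans ts.
have u0 : u 0 = 0.
  apply: (lim0 _ _ (2 * e (Num.max 0 0))) => n; have := ul 0 n.
  have -> : th n 0 = 0 by case: n => // n; exact: prim_le0.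
  by [].
have cu : continuous (pruefer_field q u) by exact: pruefer_field_continuous.
have uP t : 0 <= t -> u t = prim (pruefer_field q u) t.
  move=> t0; apply: (lim0 _ _ (e t + e t)) => n.
  have := ul t n.+1; rewrite max_l//.
  have : `|th n.+1 t - prim (pruefer_field q u) t| <= e t / 2 ^+ n.
    have -> : th n.+1 t - prim (pruefer_field q u) t =
      prim (fun s => (-1) * pruefer_field q u s + pruefer_field q (th n) s) t.
      by rewrite primD//= mulN1r addrC.
    apply: (@le_trans _ _ (prim (fun s => (2 ^+ n)^-1 * (2 * L * e s)) t)).
      apply: norm_prim_le => //.
        apply: continuous_add => //; apply: continuous_mul => //; exact:
          continuous_fcst.
      move=> s /andP[/ltW s0 _]; rewrite mulN1r addrC (le_trans (field_lip _ _
        _))//.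
      have := ul s n; rewrite max_l// -(@ler_pM2l _ L); last exact: lt_le_trans L1.
      rewrite distrC.
      by move=> /le_trans; apply; rewrite le_eqVlt; apply/orP; left; apply/eqP;
        field; rewrite expf_neq0.
    rewrite prim_e// mulrC ler_wpM2r ?invr_ge0 ?exprn_ge0//; lra.
  have -> : 2 * e t / 2 ^+ n.+1 = e t / 2 ^+ n.
    by rewrite exprS; field; rewrite expf_neq0.
  have -> : u t - prim (pruefer_field q u) t =
    (u t - th n.+1 t) + (th n.+1 t - prim (pruefer_field q u) t) by ring.
  have := ler_normD (u t - th n.+1 t) (th n.+1 t - prim (pruefer_field q u) t).
  rewrite mulrDl; lra.
exists u; split => // t t0.
apply: (@near_eq_is_derive R R R (prim (pruefer_field q u)) _ t 1).
  by apply: filterS (lt_nbhsr t0) => s /ltW /uP ->.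
exact: is_derive_prim.
Qed.

End Iteration.
End Picard.

(** * Differentiability of the phase *)

Section Phase.
Variable R : realType.
Implicit Types (f g F q k u : R -> R) (a b c e t x y K : R).

(** The bound is taken on the whole line, which suits coefficients f'(u) with u extended by zero;
    the constants in the estimates below depend on q only through such a K. *)
Definition cbounded K q := continuous q /\ forall t, `|q t| <= K.

Lemma cbounded_ge0 K q : cbounded K q -> 0 <= K.
Proof. by case=> _ /(_ 0); apply: le_trans. Qed.

Lemma cbounded_cst c : cbounded `|c| (fun=> c).
Proof. by split => //; exact: continuous_fcst. Qed.

Lemma cbounded_lin K K' c q k : cbounded K q -> cbounded K' k ->
  cbounded (K + `|c| * K') (fun t => q t + c * k t).
Proof.
move=> [cq qK] [ck kK']; split; first by continuity.
by move=> t; rewrite (le_trans (ler_normD _ _))// lerD// normrM ler_wpM2l.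
Qed.

Lemma cbounded_add K K' q k : cbounded K q -> cbounded K' k ->
  cbounded (K + K') (fun t => q t + k t).
Proof.
move=> [cq qK] [ck kK']; split; first by continuity.
by move=> t; rewrite (le_trans (ler_normD _ _))// lerD.
Qed.

Lemma cboundedW K K' q : K <= K' -> cbounded K q -> cbounded K' q.
Proof. by move=> KK' [cq qK]; split => // t; exact: le_trans KK'. Qed.

(* The angle of the vector (v', v), for v'' = q v, v(0) = 0, v'(0) = 1,       *)
(* solves a first order equation.                                             *)
Definition pruefer q : R -> R := xget (fun=> 0)
  [set u | [/\ continuous u, u 0 = 0 &
    forall t, 0 < t -> is_derive t 1 u (pruefer_field q u t)]].

Definition phase q := pruefer q pi.

Lemma prueferP K q : cbounded K q -> [/\ continuous (pruefer q), pruefer q 0 = 0 &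
  forall t, 0 < t -> is_derive t 1 (pruefer q) (pruefer_field q (pruefer q) t)].
Proof. by move=> [cq qK]; have /(xgetPex (fun=> 0)) := pruefer_exists cq qK. Qed.

Lemma pruefer_continuous K q : cbounded K q -> continuous (pruefer q).
Proof. by case/prueferP. Qed.

(** In the difference of the two fields, 1 + q1 multiplies the difference of the sin^2, and q2 - q1
    multiplies a factor at most 1; so G depends on the bound of [q1] alone. *)
Lemma pruefer_gronwall K : 0 <= K -> exists2 G, 0 <= G &
  forall K' q1 q2 a b e, cbounded K q1 -> cbounded K' q2 ->
    0 <= e -> 0 <= a -> a <= b -> b <= pi ->
    (forall t, a < t < b -> `|q2 t - q1 t| <= e) ->
    `|pruefer q2 b - pruefer q1 b| <= G * (`|pruefer q2 a - pruefer q1 a| + e).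
Proof.
move=> K0; have L0 : 0 <= 1 + K by rewrite addr_ge0.
have [G G0 HG] := gronwall pi L0; exists G => //
  K' q1 q2 a b e b1 b2 e0 a0 ab bpi qe.
have [c1 _ d1] := prueferP b1; have [c2 _ d2] := prueferP b2.
apply: (HG (fun t => pruefer q2 t - pruefer q1 t) (fun t =>
  pruefer_field q2 (pruefer q2) t - pruefer_field q1 (pruefer q1) t)) => //.
- by rewrite (le_trans _ bpi)// lerBlDr lerDl.
- by continuity.
- move=> t /andP[at_ _]; have t0 : 0 < t by exact: le_lt_trans at_.
  by apply: is_derive_sub; [exact: d2|exact: d1].
move=> t tab.
have -> : pruefer_field q2 (pruefer q2) t - pruefer_field q1 (pruefer q1) t =
  - ((1 + q1 t) * (sin (pruefer q2 t) ^+ 2 - sin (pruefer q1 t) ^+ 2)) -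
  (q2 t - q1 t) * sin (pruefer q2 t) ^+ 2 by rewrite /pruefer_field; ring.
rewrite (le_trans (ler_normB _ _))// normrN lerD//.
  rewrite normrM ler_pM ?sin2_lip//.
  by rewrite (le_trans (ler_normD _ _))// normr1 lerD2l; case: b1.
rewrite normrM -[leRHS]mulr1 ler_pM ?qe//.
by rewrite normrX exprn_ile1// sin_max.
Qed.

(* [phase_var q k] is the variation of the angle when q moves along k: it     *)
(* solves y' = a y - sin(th)^2 k, y(0) = 0, where a is [phase_drift q].       *)
Definition phase_drift q t := - ((1 + q t) * sin (pruefer q t *+ 2)).

Definition phase_var q k t := - (expR (prim (phase_drift q) t) *
  prim (fun s => expR (- prim (phase_drift q) s) * (sin (pruefer q s) ^+ 2 * k s))
    t).

Definition dphase q k := phase_var q k pi.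

Lemma phase_drift_continuous K q : cbounded K q -> continuous (phase_drift q).
Proof.
move=> bq; have cu := pruefer_continuous bq; case: bq => cq _.
rewrite /phase_drift; continuity.
Qed.

Lemma phase_integrand_continuous K q k : cbounded K q -> continuous k ->
  continuous (fun s => expR (- prim (phase_drift q) s) * (sin (pruefer q s) ^+ 2 *
    k s)).
Proof.
move=> bq ck; have cu := pruefer_continuous bq.
have cd := prim_continuous (phase_drift_continuous bq); continuity.
Qed.

Lemma phase_var_continuous K q k : cbounded K q -> continuous k ->
  continuous (phase_var q k).
Proof.
move=> bq ck; have cd := prim_continuous (phase_drift_continuous bq).
have ci := prim_continuous (phase_integrand_continuous bq ck).
rewrite /phase_var; continuity.
Qed.

Lemma phase_var0 q k : phase_var q k 0 = 0.
Proof. by rewrite /phase_var !(@prim_le0 _ _ 0)// mulr0 oppr0. Qed.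

Lemma is_derive_phase_var K q k t : cbounded K q -> continuous k -> 0 < t ->
  is_derive t 1 (phase_var q k)
    (phase_drift q t * phase_var q k t - sin (pruefer q t) ^+ 2 * k t).
Proof.
move=> bq ck t0; have cd := phase_drift_continuous bq.
have d1 := is_derive_comp (is_derive_prim cd t0) (is_derive_expR _).
have d2 := is_derive_prim (phase_integrand_continuous bq ck) t0.
apply: is_derive_eq (is_derive_opp (is_derive_mul d1 d2)) _.
rewrite /phase_var mulrA -expRD subrr expR0; ring.
Qed.

Lemma dphaseD K q c k k' : cbounded K q -> continuous k -> continuous k' ->
  dphase q (fun t => c * k t + k' t) = c * dphase q k + dphase q k'.
Proof.
move=> bq ck ck'; rewrite /dphase /phase_var.
pose g k s := expR (- prim (phase_drift q) s) * (sin (pruefer q s) ^+ 2 * k s).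
move: (expR (prim (phase_drift q) pi)) => A.
rewrite [X in prim X](_ : _ = (fun s => c * g k s + g k' s)).
  rewrite (primD c (phase_integrand_continuous bq ck)
    (phase_integrand_continuous bq ck') (pi_ge0 R)) -/(g k) -/(g k').
  by ring.
by apply/funext => s; rewrite /g; ring.
Qed.

Lemma dphase_le0 K q k : cbounded K q -> continuous k ->
  (forall t, 0 < t < pi -> 0 <= k t) -> dphase q k <= 0.
Proof.
move=> bq ck k0; rewrite oppr_le0 mulr_ge0 ?expR_ge0// prim_ge0//.
  exact: phase_integrand_continuous bq ck.
by move=> s /k0 ks; rewrite mulr_ge0 ?expR_ge0// mulr_ge0// sqr_ge0.
Qed.

(** If sin(th) vanished throughout (0, pi), then th' = 1 there, so cos(th), the derivative of
    sin(th), would vanish too, against cos^2 + sin^2 = 1. *)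
Lemma pruefer_sin_neq0 K q : cbounded K q ->
  exists2 t, 0 < t < pi & sin (pruefer q t) != 0.
Proof.
move=> bq; have [cu u0 du] := prueferP bq.
apply: contrapT => h; have {}h t : 0 < t < pi -> sin (pruefer q t) = 0.
  by move=> tpi; apply/eqP; apply/negPn/negP => s0; apply: h; exists t.
pose t := pi / 2 : R; have [t0 tpi] : 0 < t /\ t < pi.
  by have := pi_gt0 R; rewrite /t; lra.
have d s : 0 < s < pi -> is_derive s 1 (pruefer q) 1.
  move=> spi; have /andP[s0 _] := spi.
  by apply: is_derive_eq (du s s0) _; rewrite /pruefer_field h// expr0n mulr0 subr0.
have d2 : is_derive t 1 (fun s => sin (pruefer q s)) (cos (pruefer q t) * 1).
  by apply: is_derive_comp (d t _) (is_derive_sin _); rewrite t0.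
have d3 : is_derive t 1 (fun s => sin (pruefer q s)) 0.
  apply: (@near_eq_is_derive R R R (cst 0) _ t 1).
  near=> s; rewrite /cst h//; apply/andP; split; near: s; [exact: lt_nbhsr|exact:
    lt_nbhsl].
have := @derive_val _ _ _ _ _ _ _ d2; rewrite (@derive_val _ _ _ _ _ _ _ d3) mulr1
  => c0.
have := cos2Dsin2 (pruefer q t); rewrite h ?t0// -c0 expr0n /= addr0 => /eqP.
by rewrite eq_sym oner_eq0.
Unshelve. all: by end_near. Qed.

(** The integrand is nonnegative and positive wherever sin(th) is nonzero. This strict sign gives
    both the monotonicity of the phase and the regularity of its level sets. *)
Lemma dphase_lt0 K q k : cbounded K q -> continuous k ->
  (forall t, 0 < t < pi -> 0 < k t) -> dphase q k < 0.
Proof.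
move=> bq ck k0; have [t tpi st] := pruefer_sin_neq0 bq.
rewrite oppr_lt0 mulr_gt0 ?expR_gt0//.
apply: (prim_gt0 (phase_integrand_continuous bq ck) _ tpi).
  by move=> s /k0/ltW ks; rewrite mulr_ge0 ?expR_ge0// mulr_ge0// sqr_ge0.
by rewrite mulr_gt0 ?expR_gt0// mulr_gt0 ?k0// lt_def sqr_ge0 sqrf_eq0 st.
Qed.

Lemma dphase_bound K : 0 <= K -> exists2 G, 0 <= G & forall q k e,
  cbounded K q -> cbounded e k -> `|dphase q k| <= G * e.
Proof.
move=> K0; have L0 : 0 <= 1 + K by rewrite addr_ge0.
have [G G0 HG] := gronwall pi L0; exists G => // q k e bq be.
have e0 := cbounded_ge0 be; have [ck ke] := be.
have -> : G * e = G * (`|phase_var q k 0| + e) by rewrite phase_var0 normr0 add0r.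
apply: (HG _ (fun t => phase_drift q t * phase_var q k t - sin (pruefer q t) ^+ 2 *
  k t)) => //.
- exact: pi_ge0.
- by rewrite subr0.
- exact: phase_var_continuous bq ck.
- by move=> t /andP[t0 _]; exact: is_derive_phase_var bq ck t0.
move=> t _; rewrite (le_trans (ler_normB _ _))// lerD//.
  rewrite normrM ler_wpM2r// normrN normrM -[leRHS]mulr1 ler_pM// ?sin_max//.
  by rewrite (le_trans (ler_normD _ _))// normr1 lerD2l; case: bq.
rewrite normrM -[leRHS]mul1r ler_pM//.
by rewrite normrX exprn_ile1// sin_max.
Qed.

(** Mean value theorem for z |-> sin(z)^2 - sin(2y) z, whose derivative sin(2z) - sin(2y) is at most
    2 |z - y| in absolute value. *)
Lemma sin2_taylor x y : `|sin x ^+ 2 - sin y ^+ 2 - sin (y *+ 2) * (x - y)| <= 2 *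
  (x - y) ^+ 2.
Proof.
pose F z := sin z ^+ 2 - sin (y *+ 2) * z.
have dF (z : R) : is_derive z 1 F (sin (z *+ 2) - sin (y *+ 2)).
  have := is_derive_sub (is_derive_sin2 z) (is_derive_mul (is_derive_cst (sin (y *+
    2)) z 1) (is_derive_id z 1)).
  by rewrite /cst mulr0 mulr1 addr0.
have cF : continuous F by rewrite /F; have := @continuous_sin R => cs; continuity.
have -> : sin x ^+ 2 - sin y ^+ 2 - sin (y *+ 2) * (x - y) = F x - F y by rewrite
  /F; ring.
have key a b : a < b -> (a = y \/ b = y) -> `|F b - F a| <= 2 * (b - a) ^+ 2.
  move=> ab yab; have [c /andP[ac cb] ->] := mvt_cont ab cF (fun z _ => dF z).
  have ba : 0 <= b - a by rewrite subr_ge0 ltW.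
  rewrite normrM (ger0_norm ba) expr2 mulrA ler_wpM2r//.
  rewrite (le_trans (sin_lip _ _))// -mulrnBl normrMn -[leLHS]mulr_natl ler_wpM2l//.
  by rewrite ler_norml; case: yab => <-; apply/andP; split; lra.
case: (ltgtP x y) => [xy|yx|->]; last by rewrite !subrr normr0 expr0n mulr0.
  have -> : (x - y) ^+ 2 = (y - x) ^+ 2 by ring.
  by rewrite distrC; apply: key; [|right].
by apply: key; [|left].
Qed.

(** The true change of angle [de] is O(e) by [pruefer_gronwall]. Its difference [r] from the linear
    variation solves the same linear equation with a forcing term made of the Taylor remainder of
    sin^2 and of k times a difference of sin^2, both O(e^2). *)
Lemma phase_taylor K : 0 <= K -> exists2 G, 0 <= G & forall q k e,
  cbounded K q -> cbounded e k ->
  `|phase (fun t => q t + k t) - phase q - dphase q k| <= G * e ^+ 2.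
Proof.
move=> K0; have L0 : 0 <= 1 + K by rewrite addr_ge0.
have [G1 G10 HG1] := pruefer_gronwall K0.
have [G G0 HG] := gronwall pi L0.
exists (G * ((1 + K) * (2 * G1 ^+ 2) + G1)).
  by rewrite !(mulr_ge0, addr_ge0)// sqr_ge0.
move=> q k e bq be; have e0 := cbounded_ge0 be; have [ck ke] := be.
have bqk := cbounded_add bq be.
set q' := fun t => q t + k t in bqk *.
have [c1 u1 d1] := prueferP bq; have [c2 u2 d2] := prueferP bqk.
pose de t := pruefer q' t - pruefer q t.
pose r t := de t - phase_var q k t.
have de_le t : 0 <= t -> t <= pi -> `|de t| <= G1 * e.
  move=> t0 tpi; have := HG1 _ _ _ _ _ _ bq bqk e0 (lexx 0) t0 tpi.
  rewrite u1 u2 subrr normr0 add0r; apply => s _.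
  by rewrite /q' addrC addKr.
have cv := phase_var_continuous bq ck.
pose E := ((1 + K) * (2 * G1 ^+ 2) + G1) * e ^+ 2.
have -> : G * ((1 + K) * (2 * G1 ^+ 2) + G1) * e ^+ 2 = G * (`|r 0| + E).
  by rewrite /r /de u1 u2 phase_var0 !subr0 normr0 add0r /E; ring.
apply: (HG r (fun t => pruefer_field q' (pruefer q') t - pruefer_field q (pruefer
  q) t -
   (phase_drift q t * phase_var q k t - sin (pruefer q t) ^+ 2 * k t))) => //.
- by rewrite /E !(mulr_ge0, addr_ge0)// sqr_ge0.
- exact: pi_ge0.
- by rewrite subr0.
- by rewrite /r /de; continuity.
- move=> t /andP[t0 _]; apply: is_derive_sub; last exact:
  is_derive_phase_var bq ck t0.
  by apply: is_derive_sub; [exact: d2|exact: d1].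
move=> t /andP[t0 tpi].
set s2 := sin (pruefer q' t) ^+ 2; set s1 := sin (pruefer q t) ^+ 2.
have -> : pruefer_field q' (pruefer q') t - pruefer_field q (pruefer q) t -
   (phase_drift q t * phase_var q k t - s1 * k t) =
   phase_drift q t * r t + (- ((1 + q t) * (s2 - s1 - sin (pruefer q t *+ 2) * de
     t))
     - k t * (s2 - s1)).
  by rewrite /pruefer_field -/s1 -/s2 /phase_drift /r /q'; ring.
have q1 : `|1 + q t| <= 1 + K.
  by rewrite (le_trans (ler_normD _ _))// normr1 lerD2l; case: bq.
rewrite (le_trans (ler_normD _ _))// lerD//.
  by rewrite normrM ler_wpM2r// normrN normrM -[leRHS]mulr1 ler_pM// sin_max.
have det := de_le t (ltW t0) (ltW tpi).
rewrite (le_trans (ler_normB _ _))// normrN.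
have -> : E = (1 + K) * (2 * G1 ^+ 2) * e ^+ 2 + G1 * e ^+ 2 by rewrite /E mulrDl.
rewrite lerD//.
  rewrite normrM -mulrA ler_pM//.
  rewrite (le_trans (sin2_taylor _ _))// -mulrA ler_wpM2l// -exprMn.
  rewrite -/(de t) -(real_normK (num_real (de t))) ler_pXn2r// nnegrE//.
  by rewrite mulr_ge0.
rewrite normrM.
have -> : G1 * e ^+ 2 = e * (G1 * e) by ring.
by rewrite ler_pM// (le_trans (sin2_lip _ _)).
Qed.

(* The quadratic Taylor remainder alone makes the differential Lipschitz:     *)
(* compare the expansions at q of j and j + c k with the one at q + j of c k, *)
(* where c scales k to the size of j.                                         *)
Lemma dphase_lip K : 0 <= K -> exists2 G, 0 <= G & forall q j k e e',
  0 < e -> 0 < e' ->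
  cbounded K q -> cbounded e j -> cbounded K (fun t => q t + j t) ->
    cbounded e' k ->
  `|dphase (fun t => q t + j t) k - dphase q k| <= G * e * e'.
Proof.
move=> K0; have [G G0 HG] := phase_taylor K0; exists (6 * G);
  first by rewrite mulr_ge0.
move=> q j k e e' e0 e'0 bq bj bqj bk.
pose c := e / e'; have c0 : 0 < c by rewrite divr_gt0.
have [cj je] := bj; have [ck ke] := bk; have [cq _] := bq; have [cqj _] := bqj.
have z : continuous (fun _ : R => 0 : R) by exact: continuous_fcst.
(* The [+ 0] gives the perturbation the shape on which [dphaseD] rewrites. *)
have bck : cbounded e (fun t => c * k t + 0).
  split; first by continuity.
  move=> t; rewrite addr0 normrM gtr0_norm// -[leRHS](divfK (lt0r_neq0 e'0)).
  by rewrite ler_wpM2l// ltW.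
have h1 := HG _ _ _ bqj bck.
have bjck : cbounded (e + e) (fun t => 1 * j t + (c * k t + 0)).
  have := cbounded_add bj bck; by under eq_fun do rewrite -[j _]mul1r.
have h2 := HG _ _ _ bq bjck.
have h3 := HG _ _ _ bq bj.
have cck : continuous (fun t => c * k t + 0) by continuity.
have d0 q' : dphase q' (fun=> 0) = 0.
  rewrite /dphase /phase_var.
  have := primD (-1) z z (pi_ge0 R); under eq_fun do rewrite mulN1r addNr.
  rewrite mulN1r addNr => p0.
  by under eq_fun do rewrite !mulr0; rewrite p0 mulr0 oppr0.
rewrite (dphaseD c bqj ck z) d0 addr0 in h1.
rewrite (dphaseD 1 bq cj cck) (dphaseD c bq ck z) d0 addr0 mul1r in h2.
have e4 : phase (fun t => q t + (1 * j t + (c * k t + 0))) =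
    phase (fun t => q t + j t + (c * k t + 0)).
  by congr phase; apply/funext => t; rewrite mul1r addrA.
rewrite e4 in h2.
(* 6 = 1 + 4 + 1: the remainders of c k at q + j, of j + c k at q, whose size is 2 e, and of j at
   q. *)
have : `|c * (dphase (fun t => q t + j t) k - dphase q k)| <= 6 * G * e ^+ 2.
  have := ler_norml; move: h1 h2 h3.
  have -> : (e + e) ^+ 2 = 4 * e ^+ 2 by ring.
  rewrite mulrBr !ler_norml => /andP[a1 a2] /andP[b1 b2] /andP[c1 c2] _.
  move: a1 a2 b1 b2 c1 c2; move: (phase _) (phase _) (phase _) (dphase _ _) (dphase
    _ _) (dphase _ _) => p1 p2 p3 D1 D2 D3.
  move: (e ^+ 2) => E; rewrite (mulrCA G 4 E) -(mulrA 6 G E); move: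
    (G * E) (c * D1) (c * D3) => GE.
  move=> *; apply/andP; split; lra.
rewrite normrM gtr0_norm// -ler_pdivlMl// => /le_trans; apply.
rewrite /c le_eqVlt; apply/orP; left; apply/eqP; field.
by rewrite !lt0r_neq0.
Qed.

Lemma derive_quad F x l c : (forall h, `|F (x + h) - F x - l * h| <= c * h ^+ 2) ->
  is_derive x 1 F l.
Proof.
move=> Fq; have c0 : 0 <= c.
  by have := le_trans (normr_ge0 _) (Fq 1); rewrite expr1n mulr1.
have cv : h^-1 *: ((F \o shift x) (h *: 1) - F x) @[h --> 0^'] --> l.
  apply/cvgrPdist_lt => e e0; near=> h.
  have h0 : h != 0 by near: h; exact: nbhs_dnbhs_neq.
  have hc : `|h| * (c + 1) < e.
    rewrite -ltr_pdivlMr ?ltr_wpDl//; near: h; apply: dnbhs0_lt.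
    by rewrite divr_gt0// ltr_wpDl.
  have -> : l - h^-1 *: ((F \o shift x) (h *: 1) - F x) =
      - (h^-1 * (F (x + h) - F x - l * h)).
    by rewrite /= /GRing.scale /= mulr1 (addrC h x); field.
  rewrite normrN normrM normfV.
  have hp : 0 < `|h| by rewrite normr_gt0.
  apply: le_lt_trans hc; rewrite ler_pdivrMl// (le_trans (Fq h))//.
  by rewrite -(real_normK (num_real h)); have := sqr_ge0 `|h|; nra.
by apply: DeriveDef; [exact: cvgP cv|exact: cvg_lim cv].
Unshelve. all: by end_near. Qed.

Lemma is_derive_phase_path K K' q k (s : R) : cbounded K q -> cbounded K' k ->
  is_derive s 1 (fun s => phase (fun t => q t + s * k t))
    (dphase (fun t => q t + s * k t) k).
Proof.
move=> bq bk; have bs := cbounded_lin s bq bk.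
have [G G0 HG] := phase_taylor (cbounded_ge0 bs).
have [ck kK] := bk; have z : continuous (fun _ : R => 0 : R) by exact:
  continuous_fcst.
apply: (@derive_quad _ _ _ (G * K' ^+ 2)) => h.
have bh : cbounded (`|h| * K') (fun t => h * k t).
  by split=> [|t]; [continuity|rewrite normrM ler_wpM2l].
have := HG _ _ _ bs bh.
have -> : (fun t => q t + s * k t + h * k t) = (fun t => q t + (s + h) * k t).
  by apply/funext => t; ring.
rewrite exprMn real_normK ?num_real// mulrCA mulrC.
have := dphaseD h bs ck z.
have -> : dphase (fun t => q t + s * k t) (fun=> 0) = 0.
  have := dphaseD (-1) bs z z; under [X in dphase _ X]eq_fun do rewrite mulN1r
    addNr.
  by rewrite mulN1r addNr.
rewrite addr0; under [X in dphase _ X]eq_fun do rewrite addr0.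
by move=> ->; rewrite (mulrC h).
Qed.

Lemma phase_path K K' q k : cbounded K q -> cbounded K' k ->
  exists c, phase (fun t => q t + k t) - phase q = dphase (fun t =>
    q t + c * k t) k.
Proof.
move=> bq bk; have d s := is_derive_phase_path s bq bk.
have [|c _] := @mvt_cont R (fun s => phase (fun t =>
  q t + s * k t)) _ 0 1 ltr01 _ (fun s _ => d s).
  by move=> s; exact: is_derive_cont (d s).
rewrite subr0 mulr1; move=> e; exists c; rewrite -e; congr (phase _ - phase _);
  apply/funext => t.
  by rewrite mul1r.
by rewrite mul0r addr0.
Qed.

(** By the mean value theorem on the segment from q1 to q2, the increment is a differential in the
    direction q2 - q1, whose sign is known. *)
Lemma phase_le K K' q1 q2 : cbounded K q1 -> cbounded K' q2 ->
  (forall t, 0 < t < pi -> q1 t <= q2 t) -> phase q2 <= phase q1.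
Proof.
move=> b1 b2 q12; have b := cbounded_lin (-1) b2 b1.
have [c] := phase_path b1 b.
have -> : (fun t => q1 t + (q2 t + -1 * q1 t)) = q2 by apply/funext => t; ring.
move=> e; rewrite -subr_le0 e; apply: (dphase_le0 (cbounded_lin c b1 b) b.1).
by move=> t /q12; rewrite mulN1r subr_ge0.
Qed.

Lemma phase_lt K K' q1 q2 : cbounded K q1 -> cbounded K' q2 ->
  (forall t, 0 < t < pi -> q1 t < q2 t) -> phase q2 < phase q1.
Proof.
move=> b1 b2 q12; have b := cbounded_lin (-1) b2 b1.
have [c] := phase_path b1 b.
have -> : (fun t => q1 t + (q2 t + -1 * q1 t)) = q2 by apply/funext => t; ring.
move=> e; rewrite -subr_lt0 e; apply: (dphase_lt0 (cbounded_lin c b1 b) b.1).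
by move=> t /q12; rewrite mulN1r subr_gt0.
Qed.

End Phase.

(** * The argument function *)

Section ArgumentIsPhase.
Variable R : realType.
Implicit Types (f q v dv w : R -> R) (t x K : R).

Definition clamp t : R := Num.max 0 (Num.min t pi).

Lemma clamp_id t : 0 <= t <= pi -> clamp t = t.
Proof. by move=> /andP[t0 tpi]; rewrite /clamp min_l// max_r. Qed.

Lemma clamp_itv t : 0 <= clamp t <= pi.
Proof. by rewrite /clamp le_max lexx /= ge_max pi_ge0 ge_min lexx orbT. Qed.

Lemma clamp_continuous (F : R -> R) : {within `[0, pi], continuous F} ->
  continuous (fun t => F (clamp t)).
Proof. by move=> cF; exact: continuous_clamp (pi_ge0 R) cF. Qed.

Lemma is_derive_clamp (F : R -> R) t a : 0 < t < pi -> is_derive t 1 F a ->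
  is_derive t 1 (fun s => F (clamp s)) a.
Proof.
move=> /andP[t0 tpi] dF; apply: (@near_eq_is_derive R R R F _ t 1) => //.
near=> s; rewrite clamp_id//; apply/andP; split; apply: ltW; near: s;
  [exact: lt_nbhsr|exact: lt_nbhsl].
Unshelve. all: by end_near. Qed.

(** A nonzero value of d would, by the intermediate value theorem, produce a nonzero value in
    [-1, 1], where sin vanishes only at 0. *)
Lemma sin0_continuous_eq0 (d : R -> R) : continuous d -> d 0 = 0 ->
  (forall t, sin (d t) = 0) -> forall t, d t = 0.
Proof.
move=> cd d0 sd t.
have sin_neq0 x : x != 0 -> - 1 <= x <= 1 -> sin x != 0.
  have p2 := pi_ge2 R => x0 /andP[x1 x2]; case: (ltgtP x 0) => [xn|xp|x0'];
    last by rewrite x0' eqxx in x0.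
    rewrite -oppr_eq0 -sinN gt_eqF// sin_gt0_pi//; lra.
  by rewrite gt_eqF// sin_gt0_pi//; lra.
apply/eqP/negPn/negP => dt.
pose y := Num.max (-1) (Num.min (d t) 1).
have y0 : y != 0.
  rewrite /y; case: (ltgtP (d t) 0) dt => // h _.
    by rewrite min_l ?(le_trans (ltW h))// lt_eqF// gt_max h andbT; lra.
  by rewrite gt_eqF// lt_max lt_min h ltr01 orbT.
have y1 : -1 <= y <= 1.
  by rewrite /y le_max lexx /= ge_max ge_min lexx orbT andbT; lra.
have yd : (0 <= y <= d t) || (d t <= y <= 0).
  rewrite /y; case: (leP 0 (d t)) => h.
    by rewrite le_max le_min h ler01 orbT /= ge_max ge_min lexx /= andbT;
      apply/orP; left; lra.
  rewrite (@min_l _ _ (d t)); last by lra.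
  by apply/orP; right; rewrite le_max lexx orbT /= ge_max (ltW h) andbT; lra.
clearbody y.
have [s ds] : exists s, d s = y.
  have iv a b : a <= b -> Num.min (d a) (d b) <= y <= Num.max (d a) (d b) ->
    exists s, d s = y.
    by move=> ab /(IVT ab (continuous_subspaceT cd))[s _ <-]; exists s.
  case: (leP 0 t) => h.
    apply: (iv _ _ h); rewrite d0 ge_min le_max.
    by case/orP: yd => /andP[-> ->]; rewrite ?orbT.
  apply: (iv _ _ (ltW h)); rewrite d0 ge_min le_max.
  by case/orP: yd => /andP[-> ->]; rewrite ?orbT.
by have := sin_neq0 _ y0 y1; rewrite -ds sd eqxx.
Qed.

(** The modulus of (v', v): from rho^2 = v'^2 + v^2 and v'' = q v comes rho' = (1 + q) sin(th)
    cos(th) rho, with rho(0) = 1. *)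
Definition pruefer_radius q t :=
  expR (prim (fun s => (1 + q s) * (sin (pruefer q s) * cos (pruefer q s))) t).

Section Solution.
Variables (K : R) (q : R -> R).
Hypothesis bq : cbounded K q.
Let th := pruefer q.
Let rho := pruefer_radius q.

Let cth : continuous th. Proof. exact: pruefer_continuous bq. Qed.

Let ci : continuous (fun s => (1 + q s) * (sin (pruefer q s) * cos (pruefer q s))).
Proof. by have := cth; have := bq.1; rewrite /th => c1 c2; continuity. Qed.

Lemma pruefer_radius_continuous : continuous (pruefer_radius q).
Proof. by have := prim_continuous ci => cp; rewrite /pruefer_radius;
  continuity. Qed.

Let dr t : 0 < t -> is_derive t 1 rho (rho t * ((1 + q t) * (sin (th t) * cos (th
  t)))).
Proof. by move=> t0; exact: is_derive_comp (is_derive_prim ci t0) (is_derive_expR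
  _). Qed.

Let dth t : 0 < t -> is_derive t 1 th (1 - (1 + q t) * sin (th t) ^+ 2).
Proof. by case: (prueferP bq) => _ _ h t0; exact: (h t t0). Qed.

Lemma is_derive_pruefer_sol t : 0 < t ->
  is_derive t 1 (fun s => pruefer_radius q s * sin (pruefer q s))
    (pruefer_radius q t * cos (pruefer q t)) /\
  is_derive t 1 (fun s => pruefer_radius q s * cos (pruefer q s))
    (q t * (pruefer_radius q t * sin (pruefer q t))).
Proof.
move=> t0; have d1 := dr t0; have d2 := dth t0; split.
  apply: is_derive_eq (is_derive_mul d1 (is_derive_comp d2 (is_derive_sin _))) _.
  by rewrite -/th -/rho; ring.
apply: is_derive_eq (is_derive_mul d1 (is_derive_comp d2 (is_derive_cos _))) _.
rewrite -/th -/rho.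
transitivity (rho t * sin (th t) * ((1 + q t) * (cos (th t) ^+ 2 + sin (th t) ^+ 2)
  - 1)).
  by ring.
by rewrite cos2Dsin2; ring.
Qed.

(* The Wronskian of two solutions vanishing at 0 is zero, so two arguments    *)
(* differ by an integer multiple of pi, which is 0 by continuity.             *)
Lemma argument_pruefer v dv w :
  v 0 = 0 -> dv 0 = 1 ->
  {within `[0, pi], continuous v} -> {within `[0, pi], continuous dv} ->
  (forall t, 0 < t < pi -> is_derive t 1 v (dv t) /\
    is_derive t 1 dv (q t * v t)) ->
  is_argument v dv w -> forall t, 0 <= t <= pi -> w t = pruefer q t.
Proof.
move=> v0 dv0 cv cdv dvv [w0 cw wv] t tpi.
have cv' := clamp_continuous cv; have cdv' := clamp_continuous cdv.
have cr := pruefer_radius_continuous.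
have c1 := cth.
pose W s := v (clamp s) * (rho s * cos (th s)) - dv (clamp s) * (rho s * sin (th
  s)).
have cW : continuous W by rewrite /W /rho; continuity.
have W0 s : 0 <= s <= pi -> W s = 0.
  move=> /andP[s0 spi].
  have -> : 0 = W 0.
    have [_ th0 _] := prueferP bq.
    by rewrite /W clamp_id ?lexx ?pi_ge0// v0 mul0r /th th0 sin0 !mulr0 subr0.
  apply/esym; apply: (@derive_0_eq R W (fun s =>
    v (clamp s) * (q s * (rho s * sin (th s))) + rho s * cos (th s) * dv s -
    (dv (clamp s) * (rho s * cos (th s)) + rho s * sin (th s) * (q s * v s)))) =>
      //.
    move=> x /andP[x0 xs]; have xpi : 0 < x < pi by rewrite x0 (lt_le_trans xs).
    have [p1 p2] := is_derive_pruefer_sol x0; have [d1 d2] := dvv _ xpi.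
    apply: is_derive_sub; apply: is_derive_mul => //; exact: is_derive_clamp.
  move=> x /andP[x0 xs]; rewrite clamp_id; first by ring.
  by rewrite !ltW// (lt_le_trans xs).
(* In polar form the Wronskian is r rho sin(w - th), with r and rho positive. *)
have sin0 s : sin (w (clamp s) - th (clamp s)) = 0.
  have h := clamp_itv s; have := W0 _ h.
  rewrite /W clamp_id//; have [r [r0 -> ->]] := wv (clamp s) h.
  rewrite sinB => e; apply/eqP; have rr : r * rho (clamp s) != 0.
    by rewrite mulf_neq0 ?gt_eqF// expR_gt0.
  by rewrite -(mulrI_eq0 _ (mulfI rr)) -e; apply/eqP; ring.
have cd : continuous (fun s => w (clamp s) - th (clamp s)).
  have cwc := clamp_continuous cw.
  have cthc := clamp_continuous (continuous_subspaceT cth).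
  by continuity.
have [_ th0 _] := prueferP bq.
have d0 : w (clamp 0) - th (clamp 0) = 0.
  by rewrite clamp_id ?lexx ?pi_ge0// w0 /th th0 subrr.
have := sin0_continuous_eq0 cd d0 sin0 t; rewrite clamp_id// => /eqP.
by rewrite subr_eq0 => /eqP.
Qed.

End Solution.

(** The Pruefer angle is itself an argument of a solution, so the choice in [argW] never falls back
    on its default; any argument it picks agrees with the Pruefer angle on [0, pi]. *)
Lemma argW_phase K f (u : sobolevD R) : cbounded K (fun t => derive1 f (u t)) ->
  argW f u pi = phase (fun t => derive1 f (u t)).
Proof.
move=> bq; set q := fun t => derive1 f (u t) in bq *.
have [cth th0 dth] := prueferP bq; have cr := pruefer_radius_continuous bq.
pose v s := pruefer_radius q s * sin (pruefer q s).
pose dv s := pruefer_radius q s * cos (pruefer q s).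
have : exists w, exists v dv, is_ivp_sol f u v dv /\ is_argument v dv w.
  exists (pruefer q), v, dv; split.
    split.
    - by rewrite /v th0 sin0 mulr0.
    - by rewrite /dv th0 cos0 mulr1 /pruefer_radius prim_le0// expR0.
    - by apply: continuous_subspaceT; rewrite /v; continuity.
    - by apply: continuous_subspaceT; rewrite /dv; continuity.
    - move=> t; rewrite in_itv /= => /andP[t0 _].
      exact: is_derive_pruefer_sol bq t t0.
  split => //; first exact: continuous_subspaceT.
  by move=> t _; exists (pruefer_radius q t); split => //; exact: expR_gt0.
move=> /(xgetPex (fun=> 0)) [v' [dv' [[v0 dv0 cv cdv ds] ar]]].
apply: (argument_pruefer bq v0 dv0 cv cdv _ ar).
  by move=> t tpi; apply: ds; rewrite in_itv.
by rewrite pi_ge0 lexx.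
Qed.

Lemma sin_natmul_pi (j : nat) : sin (j%:R * pi) = 0 :> R.
Proof.
elim: j => [|j IH]; first by rewrite mul0r sin0.
by rewrite -natr1 mulrDl mul1r sinDpi IH oppr0.
Qed.

(** The solution for the constant - j^2 is sin(jt) / j; a continuous argument of it is written down
    and read off at pi. *)
Lemma phase_const (j : nat) : (0 < j)%N -> phase (fun=>
  - (j%:R ^+ 2)) = j%:R * pi :> R.
Proof.
move=> j0; have n0 : j%:R != 0 :> R by rewrite pnatr_eq0 -lt0n.
set n : R := j%:R in n0 *.
have np : 0 < n by rewrite ltr0n.
(* The angle of (cos nt, sin nt / n) stays within pi / 2 of nt.               *)
pose Y t := cos (n * t) ^+ 2 + sin (n * t) ^+ 2 / n.
pose X t := (n^-1 - 1) * (sin (n * t) * cos (n * t)).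
(* [Y t] and [X t] are the coordinates of that vector in the frame rotated by nt; as [Y t] is
   positive, the arctangent of their quotient is the remaining angle. *)
pose w t := n * t + atan (X t / Y t).
have Y0 t : 0 < Y t.
  have := cos2Dsin2 (n * t) => cs.
  rewrite lt_neqAle addr_ge0 ?divr_ge0 ?sqr_ge0 ?ltW// andbT eq_sym; apply/eqP => e.
  move/eqP : e; rewrite /Y paddr_eq0 ?divr_ge0 ?sqr_ge0 ?ltW//.
  rewrite !mulf_eq0 invr_eq0 (negPf n0) orbF !orbb => /andP[/eqP c0 /eqP s0].
  by move: cs; rewrite c0 s0 ?expr0n /= addr0 => /eqP; rewrite eq_sym oner_eq0.
have cn : continuous (fun t : R => n * t) by continuity.
have cX : continuous X by rewrite /X; continuity.
have cY : continuous Y by rewrite /Y; continuity.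
have dn t : is_derive t 1 (fun t : R => n * t) n.
  apply: is_derive_eq (is_derive_mul (is_derive_cst n t 1) (is_derive_id t 1)) _.
  by rewrite /cst; ring.
have <- : w pi = n * pi.
  by rewrite /w /X sin_natmul_pi mul0r mulr0 mul0r atan0 addr0.
apply/esym; apply: (@argument_pruefer _ _ (cbounded_cst (- n ^+ 2)) (fun t =>
  n^-1 * sin (n * t)) (fun t => cos (n * t))).
- by rewrite mulr0 sin0 mulr0.
- by rewrite mulr0 cos0.
- by apply: continuous_subspaceT; continuity.
- by apply: continuous_subspaceT; continuity.
- move=> t _; split.
    apply: is_derive_eq (is_derive_mul (is_derive_cst (n^-1) t 1) (is_derive_comp
      (dn t) (is_derive_sin _))) _.
    by rewrite /cst; field.
  apply: is_derive_eq (is_derive_comp (dn t) (is_derive_cos _)) _.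
  by field.
- split.
  + by rewrite /w /X mulr0 sin0 mul0r mulr0 mul0r atan0 addr0.
  + apply: continuous_subspaceT => t; apply: cvgD; first exact: cn.
    apply: (@continuous_comp _ _ _ (fun t => X t / Y t) atan); last exact:
      continuous_atan.
    apply: cvgM; first exact: cX.
    by apply: cvgV; [rewrite gt_eqF|exact: cY].
  move=> t _; have Yt := Y0 t; have Yn0 : Y t != 0 by rewrite gt_eqF.
  pose z := X t / Y t; pose k := (Num.sqrt (1 + z ^+ 2))^-1.
  have k0 : 0 < k by rewrite invr_gt0 sqrtr_gt0 ltr_pwDl// sqr_ge0.
  have ca : cos (atan z) = k by rewrite cos_atan.
  have sa : sin (atan z) = z * k.
    by rewrite -ca -{2}(atanK z) /tan divfK// ca gt_eqF.
  have cs := cos2Dsin2 (n * t).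
  exists (Y t / k); split; first by rewrite divr_gt0.
    rewrite /w cosD -/z ca sa.
    have -> : Y t / k * (cos (n * t) * k - sin (n * t) * (z * k)) =
       cos (n * t) * Y t - sin (n * t) * X t.
      by rewrite /z; field; rewrite Yn0 gt_eqF.
    rewrite -[LHS]mulr1 -cs /X /Y; field; exact: n0.
  rewrite /w sinD -/z ca sa.
  have -> : Y t / k * (sin (n * t) * k + cos (n * t) * (z * k)) =
     sin (n * t) * Y t + cos (n * t) * X t.
    by rewrite /z; field; rewrite Yn0 gt_eqF.
  rewrite -[LHS]mulr1 -cs /X /Y; field; exact: n0.
- by rewrite pi_ge0 lexx.
Qed.

End ArgumentIsPhase.

(** * Values of the phase along a line *)

Section PhaseRange.
Variable R : realType.
Implicit Types (phi q h p : R -> R) (c e t x K B s d : R).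

Lemma cbounded_comp B phi h : continuous phi -> cbounded B h ->
  exists K, cbounded K (fun t => phi (h t)).
Proof.
move=> cphi [ch hB]; have [K _ phiK] := continuous_bounded_itv (- B) B cphi.
exists K; split; first by have := continuous_fcomp ch cphi.
by move=> t; apply: phiK; rewrite -ler_norml.
Qed.

Lemma pruefer_lip K q a b : cbounded K q -> 0 <= a -> a <= b ->
  `|pruefer q b - pruefer q a| <= (2 + K) * (b - a).
Proof.
move=> bq a0; have [cu _ du] := prueferP bq.
rewrite le_eqVlt => /predU1P[->|ab]; first by rewrite !subrr normr0 mulr0.
have [|c /andP[ac _] ->] := mvt_cont (F' := pruefer_field q (pruefer q)) ab cu.
  by move=> t /andP[at_ _]; apply: du; exact: le_lt_trans at_.
rewrite normrM (ger0_norm (_ : 0 <= b - a)) ?subr_ge0 ?(ltW ab)//.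
rewrite ler_wpM2r ?subr_ge0 ?(ltW ab)// /pruefer_field (le_trans (ler_normB _ _))//.
have -> : 2 + K = 1 + (1 + K) by ring.
rewrite normr1 lerD2l normrM -[leRHS]mulr1 ler_pM//.
  by rewrite (le_trans (ler_normD _ _))// normr1 lerD2l; case: bq.
by rewrite normrX exprn_ile1// sin_max.
Qed.

(** On the two end intervals of length d the angles move by O(d), whatever q is; in between the
    coefficients coincide, and the discrepancy at d grows at most by the factor G. *)
Lemma phase_near_const K c e : `|c| <= K -> 0 < e ->
  exists d, [/\ 0 < d, d < pi / 2 & forall q, cbounded K q ->
    (forall t, d < t < pi - d -> q t = c) ->
    `|phase q - phase (fun=> c)| < e].
Proof.
move=> cK e0; have K0 : 0 <= K by exact: le_trans cK.
have [G G0 HG] := pruefer_gronwall K0.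
have bc := cboundedW cK (cbounded_cst c).
(* Two angles with Lipschitz constant 2 + K contribute 2 (2 + K) d at the right end, and G times as
   much inherited from the left end. *)
pose M := 2 * (2 + K) * (G + 1).
have M0 : 0 < M by rewrite /M !mulr_gt0//; lra.
have eM : 0 < e / (2 * M) by rewrite divr_gt0// mulr_gt0.
pose d := Num.min (pi / 4) (e / (2 * M)).
have p0 := pi_gt0 R.
have d0 : 0 < d by rewrite lt_min eM andbT; lra.
have d1 : d <= pi / 4 by rewrite ge_min lexx.
have d2 : d * M < e.
  have : d <= e / (2 * M) by rewrite ge_min lexx orbT.
  by rewrite ler_pdivlMr ?mulr_gt0//; lra.
exists d; split => //; first by lra.
move=> q bq qc; clearbody d.
have h1 := pruefer_lip bq (lexx 0) (ltW d0).
have h2 := pruefer_lip bc (lexx 0) (ltW d0).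
have b1 : 0 <= pi - d by lra.
have b2 : pi - d <= pi by lra.
have b3 : d <= pi - d by lra.
have h3 := pruefer_lip bq b1 b2.
have h4 := pruefer_lip bc b1 b2.
have h5 := HG _ _ _ _ _ 0 bc bq (lexx 0) (ltW d0) b3 b2.
have {}h5 : `|pruefer q (pi - d) - pruefer (fun=> c) (pi - d)| <=
    G * `|pruefer q d - pruefer (fun=> c) d|.
  by move: h5; rewrite addr0; apply => t /qc ->; rewrite subrr normr0.
have [_ z1 _] := prueferP bq; have [_ z2 _] := prueferP bc.
move: h1 h2 h3 h4 h5; rewrite z1 z2 /phase !subr0.
have -> : pi - (pi - d) = d by ring.
move: (pruefer q d) (pruefer (fun=> c) d) (pruefer q (pi - d)) (pruefer (fun=>
  c) (pi - d)) (pruefer q pi) (pruefer (fun=> c) pi) =>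
  a1 a2 a3 a4 a5 a6 h1 h2 h3 h4 h5.
apply: le_lt_trans d2.
have -> : a5 - a6 = (a5 - a3) + (a3 - a4) - (a6 - a4) by ring.
have l1 := ler_normB (a5 - a3 + (a3 - a4)) (a6 - a4).
have l2 := ler_normD (a5 - a3) (a3 - a4).
have l3 := ler_normB a1 a2.
have l4 : G * `|a1 - a2| <= G * (2 * ((2 + K) * d)) by rewrite ler_wpM2l//; lra.
have -> : d * M = 2 * ((2 + K) * d) + G * (2 * ((2 + K) * d)) by rewrite /M; ring.
lra.
Qed.

Lemma pos_min_itv p d : continuous p -> (forall t, 0 < t < pi -> 0 < p t) ->
  0 < d -> d < pi / 2 ->
  exists2 m, 0 < m & forall t, d < t < pi - d -> m <= p t.
Proof.
move=> cp p0 d0 dpi; have ab : d <= pi - d by lra.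
have [c] := EVT_min ab (continuous_subspaceT cp).
rewrite in_itv /= => /andP[c1 c2] cmin; exists (p c); first by apply: p0; lra.
by move=> t /andP[t1 t2]; apply: cmin; rewrite in_itv /= !ltW.
Qed.

Section Monotone.
Variables (h p : R -> R) (B B' : R).
Hypotheses (bh : cbounded B h) (bp : cbounded B' p).
Hypothesis p_ge0 : forall t, 0 <= p t.
Hypothesis p_gt0 : forall t, 0 < t < pi -> 0 < p t.

(* Truncating f'(h + s p) at the level c beyond phi x keeps it bounded        *)
(* uniformly in s, and makes it equal to c away from 0 and pi for large |s|.  *)
Lemma phase_range_incr phi x : continuous phi -> {homo phi : x y / x < y} ->
  (exists s, phase (fun t => phi (h t + s * p t)) < phase (fun=> phi x)) /\
  (exists s, phase (fun=> phi x) < phase (fun t => phi (h t + s * p t))).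
Proof.
move=> cphi phi_lt.
have phi_le a b : a <= b -> phi a <= phi b.
  by rewrite le_eqVlt => /predU1P[->//|/phi_lt/ltW].
have B0 := cbounded_ge0 bh; have [ch hB] := bh.
have bhs s := cbounded_lin s bh bp.
have nB t : - B <= h t <= B by rewrite -ler_norml.
split.
  (* [K] must not involve s, because d is chosen from [K] and s from d. *)
  pose c := phi (x + 1); pose K := `|phi (- B)| + `|c|.
  have cK : `|c| <= K by rewrite lerDr.
  have Tc : 0 < phase (fun=> phi x) - phase (fun=> c).
    rewrite subr_gt0; apply: (phase_lt (cbounded_cst _) (cbounded_cst _)) => t _.
    by apply: phi_lt; rewrite ltrDl.
  have [d [d0 dpi Hd]] := phase_near_const cK Tc.
  have [m m0 pm] := pos_min_itv bp.1 p_gt0 d0 dpi.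
  (* Where p >= m this gives h + s p >= - B + |x + 1| + B >= x + 1, so the truncation equals c
     there. *)
  pose s := (`|x + 1| + B) / m; exists s.
  have s0 : 0 <= s by rewrite divr_ge0 ?addr_ge0// ltW.
  have [K1 bK1] := cbounded_comp cphi (bhs s).
  pose q t := Num.min (phi (h t + s * p t)) c.
  have bq : cbounded K q.
    split; first by have := bK1.1 => cc; rewrite /q; continuity.
    move=> t; rewrite ler_norml; apply/andP; split; last first.
      by rewrite ge_min (le_trans (ler_norm c))// orbT.
    rewrite lerNl /q; case: (leP (phi _) c) => _;
      last by rewrite (le_trans (ler_norm _))// normrN lerDr.
    apply: (@le_trans _ _ (- phi (- B))); last by rewrite (le_trans (ler_norm _))//
      normrN lerDl.
    rewrite lerN2; apply: phi_le; have := nB t; have := mulr_ge0 s0 (p_ge0 t); lra.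
  have : phase (fun t => phi (h t + s * p t)) <= phase q.
    by apply: (phase_le bq bK1) => t _; rewrite ge_min lexx.
  move=> /le_lt_trans; apply.
  have : `|phase q - phase (fun=> c)| < phase (fun=> phi x) - phase (fun=> c).
    apply: Hd => // t td; rewrite /q min_r//; apply: phi_le.
    have : s * m <= s * p t by rewrite ler_wpM2l// pm.
    rewrite {1}/s divfK ?gt_eqF//; have := nB t; have := ler_norm (x + 1); lra.
  by move=> /(le_lt_trans (ler_norm _)); rewrite ltrD2r.
pose c := phi (x - 1); pose K := `|phi B| + `|c|.
have cK : `|c| <= K by rewrite lerDr.
have Tc : 0 < phase (fun=> c) - phase (fun=> phi x).
  rewrite subr_gt0; apply: (phase_lt (cbounded_cst _) (cbounded_cst _)) => t _.
  by apply: phi_lt; rewrite gtrBl.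
have [d [d0 dpi Hd]] := phase_near_const cK Tc.
have [m m0 pm] := pos_min_itv bp.1 p_gt0 d0 dpi.
pose s := (`|x - 1| + B) / m; exists (- s).
have s0 : 0 <= s by rewrite divr_ge0 ?addr_ge0// ltW.
have [K1 bK1] := cbounded_comp cphi (bhs (- s)).
pose q t := Num.max (phi (h t + - s * p t)) c.
have bq : cbounded K q.
  split; first by have := bK1.1 => cc; rewrite /q; continuity.
  move=> t; rewrite ler_norml; apply/andP; split.
    by rewrite lerNl /q lerNl le_max; apply/orP; right;
      rewrite lerNl (le_trans (ler_norm (- c)))// normrN lerDr.
  rewrite /q; case: (leP (phi _) c) => _; first by rewrite (le_trans (ler_norm
    _))// lerDr.
  apply: (@le_trans _ _ (phi B)); last by rewrite (le_trans (ler_norm _))// lerDl.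
  apply: phi_le; have := nB t; have := mulr_ge0 s0 (p_ge0 t); lra.
have : phase q <= phase (fun t => phi (h t + - s * p t)).
  by apply: (phase_le bK1 bq) => t _; rewrite le_max lexx.
apply: lt_le_trans.
have : `|phase q - phase (fun=> c)| < phase (fun=> c) - phase (fun=> phi x).
  apply: Hd => // t td; rewrite /q max_r//; apply: phi_le.
  have : s * m <= s * p t by rewrite ler_wpM2l// pm.
  rewrite {1}/s divfK ?gt_eqF//; have := nB t; have := ler_norm (- (x - 1));
    rewrite normrN; lra.
by rewrite ltr_norml => /andP[+ _]; rewrite opprB ltrD2r.
Qed.

End Monotone.

(** A decreasing phi becomes increasing after composing with y |-> - y, which replaces h by - h and
    reverses s. Since h is arbitrary, all lines pass on both sides of the same phases. *)
Lemma phase_range phi h p B B' x : continuous phi ->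
  {homo phi : x y / x < y} \/ {homo phi : x y /~ x < y} ->
  cbounded B h -> cbounded B' p ->
  (forall t, 0 <= p t) -> (forall t, 0 < t < pi -> 0 < p t) ->
  (exists s, phase (fun t => phi (h t + s * p t)) < phase (fun=> phi x)) /\
  (exists s, phase (fun=> phi x) < phase (fun t => phi (h t + s * p t))).
Proof.
move=> cphi + bh bp p0 pp; case=> mphi; first exact:
  (phase_range_incr bh bp p0 pp _ cphi mphi).
pose psi y := phi (- y).
have cpsi : continuous psi.
  by apply: continuous_fcomp cphi; apply: continuous_opp; exact: continuous_fid.
have mpsi : {homo psi : x y / x < y} by move=> a b ab; apply: mphi; rewrite ltrN2.
have bNh : cbounded B (fun t => - h t).
  by split=> [|t]; [apply: continuous_opp; exact: bh.1|rewrite normrN; exact: bh.2].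
have := phase_range_incr bNh bp p0 pp (- x) cpsi mpsi; rewrite /psi opprK.
have e s : (fun t => phi (- (- h t + s * p t))) = (fun t => phi (h t + - s * p t)).
  by apply/funext => t; congr phi; ring.
by move=> [[s1 h1] [s2 h2]]; split; [exists (- s1); rewrite -e|exists (- s2);
  rewrite -e].
Qed.

(** Heine's theorem with only x confined to [-B, B], by compactness applied to the filter of small
    positive d. *)
Lemma continuous_uniform_itv phi B e : continuous phi -> 0 < e ->
  exists2 d, 0 < d & forall x y, `|x| <= B -> `|y - x| < d -> `|phi y - phi x| <= e.
Proof.
move=> cphi e0; have cB : compact `[- B, B]%classic by exact: segment_compact.
have /compact_near_coveringP := cB.
move=> /(_ R 0^'+ (fun d x => forall y, `|y - x| < d -> `|phi y - phi x| <= e)).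
case.
  move=> x _; have e2 : 0 < e / 2 by rewrite divr_gt0.
  have /cvgrPdist_lt/(_ _ e2)/nbhs_ballP[r /= r0 Hr] := cphi x.
  have r2 : 0 < r / 2 by rewrite divr_gt0.
  exists (ball x (r / 2), [set d | d <= r / 2]).
    by split => /=; [exact: nbhsx_ballx|exact: nbhs_right_le].
  move=> [z d] [/= xz dr] y yz.
  have h1 := Hr z; have h2 := Hr y; rewrite /ball /= in xz h1 h2.
  have {}h1 : `|phi x - phi z| < e / 2 by apply: h1; lra.
  have {}h2 : `|phi x - phi y| < e / 2.
    apply: h2; have -> : x - y = (x - z) - (y - z) by ring.
    by have := ler_normB (x - z) (y - z); lra.
  have -> : phi y - phi z = (phi x - phi z) - (phi x - phi y) by ring.
  by have := ler_normB (phi x - phi z) (phi x - phi y); lra.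
move=> r /= r0 Hr; exists (r / 2); first by rewrite divr_gt0.
move=> x y xB; apply: (Hr (r / 2)) => /=.
- by rewrite sub0r normrN gtr0_norm ?divr_gt0//; lra.
- by rewrite divr_gt0.
- by rewrite in_itv /= -ler_norml.
Qed.

End PhaseRange.

(** * The Sobolev space *)

Section SobolevBounds.
Variable R : realType.
Local Notation mu := (@lebesgue_measure R).
Implicit Types (u h p : sobolevD R) (t : R).

Lemma sobolevD_out u t : ~~ (0 < t < pi) -> u t = 0.
Proof.
have [_ _ u0 upi uN] := sobolevDP u; move=> tN.
have [t0|t0] := eqVneq t 0; first by rewrite t0.
have [tp|tp] := eqVneq t pi; first by rewrite tp.
apply: uN; rewrite in_itv /=; apply: contra tN.
by rewrite !le_eqVlt (eq_sym 0) (negPf t0) (negPf tp).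
Qed.

(** On [0, pi] u is a primitive; the zero boundary values make u equal to its composition with
    [clamp]. *)
Lemma sobolevD_continuous u : continuous u.
Proof.
have [_ [d [[sd ud] _]] u0 upi uN] := sobolevDP u.
have cu : {within `[0, pi], continuous u}.
  have cI := parameterized_integral_continuous (pi_ge0 R) (sqint_integrable sd).
  apply: (@subspace_eq_continuous _ _ _
    (fun x => u 0 + parameterized_integral mu 0 x d.1)).
    by move=> x /set_mem Dx; rewrite /= [RHS]ud.
  by move=> x; apply: cvgD; [exact: cvg_cst|exact: cI].
have := clamp_continuous cu.
rewrite (_ : (fun t => u (clamp t)) = u)//.
apply/funext => t; have [tpi|tN] := boolP (0 <= t <= pi); first by rewrite clamp_id.
rewrite (uN t)// /clamp; case: (leP 0 t) tN => [t0|t0 _] /=.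
  by rewrite -ltNge => tpi; rewrite min_r ?(ltW tpi)// max_r ?pi_ge0.
by rewrite max_l// ge_min (ltW t0).
Qed.

(** Sobolev embedding: u(0) = 0, so u(t) is the integral of u', and on the unit sphere the integral
    of (1 + u'^2) / 2 over [0, pi] is at most (pi + 1) / 2. *)
Lemma sobolevD_sup : exists2 C : R, 0 < C & forall u t, `|u t| <= C * `|u|.
Proof.
have p0 := pi_gt0 R.
exists ((pi + 1) / 2); first by lra.
(* On the unit sphere 2 |u'| <= 1 + u'^2 suffices; then scale. *)
have unit_ball u t : `|u| = 1 -> `|u t| <= (pi + 1) / 2.
  move=> u1; have [tpi|/sobolevD_out ->] := boolP (0 < t < pi);
    last by rewrite normr0; lra.
  have [su [d ud] u0 _ _] := sobolevDP u.
  have d1 : l2prod d.1 d.1 <= 1.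
    have := u1; rewrite sobolevD_normE (H2_normE ud) => /(congr1 (fun x => x ^+ 2)).
    rewrite expr1n sqr_sqrtr ?addr_ge0 ?l2prod_ge0// => <-.
    by rewrite -addrA addrCA lerDl addr_ge0 ?l2prod_ge0.
  have [[sd ude] _] := ud.
  have Dt : `[0, pi]%classic t by rewrite /= in_itv /= !ltW//; case/andP: tpi.
  have sub : `[0, t] `<=` `[0, pi].
    by move=> x /=; rewrite !in_itv /= => /andP[-> /le_trans]; apply; apply: ltW;
      case/andP: tpi.
  have mD : measurable (`[0, pi]%classic : set (measurableTypeR R)) by exact:
    measurable_itv.
  have mt : measurable (`[0, t]%classic : set (measurableTypeR R)) by exact:
    measurable_itv.
  have id1 := sqint_integrable sd.
  have i1 : mu.-integrable `[0, pi] (EFin \o (fun s => (1 + d.1 s ^+ 2) / 2)).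
    have i2 : mu.-integrable `[0, pi] (EFin \o (fun s => 1 + d.1 s ^+ 2)).
      have ic : mu.-integrable `[0, pi] (EFin \o (fun _ : R => 1 : R)).
        exact: continuous_integrable (@continuous_fcst R 1).
      exact: (integrableD mD ic sd.2).
    have := integrableZl mD (2^-1) i2.
    by apply: eq_integrable => // s _ /=; rewrite -EFinM mulrC.
  have i1t := integrableS mD mt sub i1.
  have idt := integrableS mD mt sub id1.
  have bound (g : R -> R) : mu.-integrable `[0, t] (EFin \o g) ->
      (forall s, g s <= (1 + d.1 s ^+ 2) / 2) -> \int[mu]_(s in `[0,
        t]) g s <= (pi + 1) / 2.
    move=> ig gle.
    apply: (@le_trans _ _ (\int[mu]_(s in `[0, t]) ((1 + d.1 s ^+ 2) / 2))).
      by apply: le_Rintegral.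
    apply: (@le_trans _ _ (\int[mu]_(s in `[0, pi]) ((1 + d.1 s ^+ 2) / 2))).
      rewrite /Rintegral fine_le//; [exact: integrable_fin_num i1t|exact:
        integrable_fin_num i1|].
      apply: ge0_subset_integral => //; first by case/integrableP: i1.
      by move=> s _; rewrite lee_fin divr_ge0// addr_ge0// sqr_ge0.
    under eq_Rintegral do rewrite mulrC.
    rewrite RintegralZl//; last exact: (integrableD mD (continuous_integrable 0 pi
      (@continuous_fcst R 1)) sd.2).
    rewrite RintegralD//; [|exact: continuous_integrable (@continuous_fcst R
      1)|exact: sd.2].
    rewrite Rintegral_cst// mul1r.
    have m : lebesgue_measure [set` `[0, pi : R]] = pi%:E.
      by rewrite lebesgue_measure_itv /= lte_fin p0 -EFinD /= subr0.
    have /= -> : mu `[0, pi]%classic = pi%:E by exact: m.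
    have : \int[mu]_(s in `[0, pi]) (d.1 s ^+ 2) <= 1 by exact: d1.
    by lra.
  rewrite ude// u0 add0r ler_norml; apply/andP; split.
    rewrite lerNl -mulN1r -RintegralZl//; apply: bound => [|s].
      by have := integrableZl mt (-1) idt; apply: eq_integrable => // s _ /=;
        rewrite -EFinM.
    by have := sqr_ge0 (d.1 s + 1); lra.
  by apply: bound => // s; have := sqr_ge0 (d.1 s - 1); lra.
move=> u t; have [->|u0] := eqVneq u 0; first by rewrite !normr0 mulr0.
have nu : 0 < `|u| by rewrite normr_gt0.
have := unit_ball (`|u|^-1 *: u) t.
rewrite normrZ normfV normr_id mulVf ?gt_eqF// => /(_ erefl).
have -> : (`|u|^-1 *: u : sobolevD R) t = `|u|^-1 * u t by [].
by rewrite normrM normfV normr_id mulrC ler_pdivrMr.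
Qed.

Lemma sobolevD_cbounded u : exists B, cbounded B u.
Proof.
have [C _ HC] := sobolevD_sup; exists (C * `|u|); split => //.
exact: sobolevD_continuous.
Qed.

Lemma l2prod_self_gt0 p : (forall t, 0 < t < pi -> 0 < p t) -> 0 < l2prod p p.
Proof.
move=> pp; have cp := @sobolevD_continuous p.
have -> : l2prod p p = prim (fun t => p t * p t) pi by rewrite /prim max_l ?pi_ge0.
have p0 := pi_gt0 R; have hpi : 0 < (pi : R) / 2 < pi by lra.
have cpp : continuous (fun t => p t * p t) by continuity.
apply: (prim_gt0 cpp _ hpi) => [s _|]; first by rewrite -expr2 sqr_ge0.
by rewrite mulr_gt0// pp.
Qed.

Lemma orth_coord_bound p : exists2 C : R, 0 < C & forall u,
  `|orth_coord p u| <= C * `|u|.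
Proof.
have [C C0 HC] := @sobolevD_sup; have [B [cp pB]] := sobolevD_cbounded p.
have B0 : 0 <= B by exact: le_trans (pB 0).
have p0 := pi_gt0 R.
exists (C * B * pi * `|l2prod p p|^-1 + 1) => [|u].
  by rewrite ltr_wpDl// !mulr_ge0// ltW.
rewrite /orth_coord normrM normfV mulrDl -[leLHS]addr0 lerD ?mul1r//.
rewrite mulrAC ler_wpM2r// mulrAC.
have -> : l2prod u p = prim (fun t => u t * p t) pi by rewrite /prim max_l ?pi_ge0.
have cu := @sobolevD_continuous u; have cup : continuous (fun t =>
  u t * p t) by continuity.
have := @prim_lip _ _ (C * `|u| * B) 0 pi cup; rewrite (@prim_le0 _ _ 0)//
  !subr0 (gtr0_norm p0).
rewrite (mulrAC C); apply => s; rewrite normrM.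
by rewrite mulrAC; apply: ler_pM => //; exact: HC.
Qed.

End SobolevBounds.

(** * The implicit function argument *)

Section Differential.
Variables (R : realType) (V W : normedModType R).
Implicit Types (x y h : V) (e d C : R).

(* The differential is an explicit family [L] of plain functions, which       *)
(* avoids building a linear map at every point.                               *)
Definition C1_with (g : V -> W) (L : V -> V -> W) : Prop :=
  forall x, [/\ (forall (a : R) h k, L x (a *: h + k) = a *: L x h + L x k),
    exists2 C, 0 < C & forall h, `|L x h| <= C * `|h|,
    forall e, 0 < e -> exists2 d, 0 < d & forall h, `|h| < d ->
      `|g (x + h) - g x - L x h| <= e * `|h|
  & forall e, 0 < e -> exists2 d, 0 < d & forall y, `|y - x| < d ->
      forall h, `|L y h - L x h| <= e * `|h|].

Lemma C1_with_diff g L x : C1_with g L ->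
  differentiable g x /\ forall h, 'd g x h = L x h.
Proof.
move=> /(_ x) [Llin [C C0 LC] gL _].
pose mx := GRing.isLinear.Build R V W *:%R (L x) Llin.
pose df : {linear V -> W} := HB.pack (L x) mx.
have cdf : continuous df.
  apply: bounded_linear_continuous; apply/linear_boundedP.
  exists C; split; first exact: num_real.
  move=> r Cr h; apply: le_trans (LC h) _.
  by rewrite ler_wpM2r// ltW.
have E : g \o shift x = cst (g x) + df +o_ 0 id.
  apply/eqaddoP => e e0; have [d d0 Hd] := gL e e0.
  apply/nbhs_ballP; exists d => //= h; rewrite -ball_normE /= sub0r normrN => /Hd.
  by rewrite !fctE /= opprD addrA (addrC h).
have dE := diff_unique cdf E.
split; last by move=> h; rewrite dE.
by apply/diff_locallyP; rewrite dE; split.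
Qed.

Lemma C1_with_on g L : C1_with g L -> C1_on setT g.
Proof.
move=> gL x _; split; first by case: (C1_with_diff x gL).
move=> e e0; have [_ _ _ /(_ e e0)[d d0 Hd]] := gL x.
apply/nbhs_ballP; exists d => //= y; rewrite -ball_normE /= distrC => yx h.
by rewrite (C1_with_diff y gL).2 (C1_with_diff x gL).2; exact: Hd.
Qed.

Lemma C1_with_cont g L x e : C1_with g L -> 0 < e ->
  exists2 d, 0 < d & forall h, `|h| < d -> `|g (x + h) - g x| < e.
Proof.
move=> /(_ x) [_ [C C0 LC] gL _] e0; have [d d0 Hd] := gL 1 ltr01.
exists (Num.min d (e / (C + 1))).
  by rewrite lt_min d0 divr_gt0// addr_gt0.
move=> h; rewrite lt_min ltr_pdivlMr ?addr_gt0// => /andP[hd he].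
have := Hd h hd; have := LC h.
have D := ler_normD (g (x + h) - g x - L x h) (L x h).
rewrite subrK in D; lra.
Qed.

End Differential.

Lemma C1_with_linear (R : realType) (V W : normedModType R) (l : V -> W) (C : R) :
  (forall (a : R) h k, l (a *: h + k) = a *: l h + l k) -> 0 < C ->
  (forall h, `|l h| <= C * `|h|) -> C1_with l (fun=> l).
Proof.
move=> llin C0 lC x; split => //; first by exists C.
  move=> e e0; exists 1 => // h _.
  have -> : l (x + h) = l x + l h by rewrite -[x in LHS]scale1r llin scale1r.
  by rewrite (addrC (l x)) addrK subrr normr0 mulr_ge0// ltW.
by move=> e e0; exists 1 => // y _ h; rewrite subrr normr0 mulr_ge0// ltW.
Qed.

Section LevelSetGraph.
Variables (R : realType) (V W : normedModType R).
(** The sign of [k] turns strict monotonicity of T along p into increase. The function [sigma]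
    solving the equation is given, so only its regularity is at stake. *)
Variables (T : V -> R) (L : V -> V -> R) (iota : W -> V) (p : V) (C k theta : R).
Variable sigma : W -> R.
Hypothesis TL : C1_with (T : V -> R^o) L.
Hypothesis iota_lin : forall (a : R) g h, iota (a *: g + h) = a *: iota g + iota h.
Hypothesis C_gt0 : 0 < C.
Hypothesis iota_le : forall h, `|iota h| <= C * `|h|.
Hypothesis Lp : forall x, L x p != 0.
Hypothesis T_mono : forall x s t, s < t -> k * T (x + s *: p) < k * T (x + t *: p).
Hypothesis T_sigma : forall h, T (iota h + sigma h *: p) = theta.

Let s h := iota h + sigma h *: p.
Let P : R := `|p| + 1.
Let P0 : 0 < P. Proof. by rewrite /P ltr_wpDl. Qed.
Let pP : `|p| <= P. Proof. by rewrite lerDl. Qed.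

Let iotaD g h : iota (g + h) = iota g + iota h.
Proof. by have := iota_lin 1 g h; rewrite !scale1r. Qed.

Let k_neq0 : k != 0.
Proof.
by apply/eqP => k0; have := T_mono 0 ltr01; rewrite k0 !mul0r ltxx.
Qed.

Let sigma_lt h t : k * T (iota h + t *: p) < k * theta -> t < sigma h.
Proof.
move=> Tt; rewrite ltNge le_eqVlt; apply/negP => /predU1P[e|/(T_mono (iota h))].
  by move: Tt; rewrite -e T_sigma ltxx.
by rewrite T_sigma => /(lt_trans Tt); rewrite ltxx.
Qed.

Let sigma_gt h t : k * theta < k * T (iota h + t *: p) -> sigma h < t.
Proof.
move=> Tt; rewrite ltNge le_eqVlt; apply/negP => /predU1P[e|/(T_mono (iota h))].
  by move: Tt; rewrite e T_sigma ltxx.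
by rewrite T_sigma => /(lt_trans Tt); rewrite ltxx.
Qed.

Let kT_cont x e : 0 < e ->
  exists2 d : R, 0 < d & forall g, `|g| < d -> `|k * T (x + iota g) - k * T x| < e.
Proof.
move=> e0; have k0 : 0 < `|k| by rewrite normr_gt0.
have [d d0 Hd] := C1_with_cont x TL (divr_gt0 e0 k0).
exists (d / C); first by rewrite divr_gt0.
move=> g; rewrite ltr_pdivlMr// mulrC => /(le_lt_trans (iota_le g))/Hd.
by rewrite ltr_pdivlMr// -mulrBr normrM mulrC.
Qed.

(** At heights sigma(h) - e and sigma(h) + e the values of k T lie strictly on either side of k
    theta, and stay there when h moves slightly; monotonicity traps the new root between these
    heights. *)
Let sigma_cont h e : 0 < e ->
  exists2 d : R, 0 < d & forall g, `|g| < d -> `|sigma (h + g) - sigma h| < e.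
Proof.
move=> e0.
have lt1 : sigma h < sigma h + e by rewrite ltrDl.
have lt2 : sigma h - e < sigma h by rewrite gtrBl.
have := T_mono (iota h) lt1; have := T_mono (iota h) lt2; rewrite T_sigma.
rewrite -subr_gt0 => a0; rewrite -subr_gt0 => b0.
have [d1 d10 H1] := kT_cont (iota h + (sigma h - e) *: p) a0.
have [d2 d20 H2] := kT_cont (iota h + (sigma h + e) *: p) b0.
exists (Num.min d1 d2); first by rewrite lt_min d10.
move=> g; rewrite lt_min => /andP[/H1 g1 /H2 g2].
have c1 : sigma h - e < sigma (h + g).
  apply: sigma_lt; rewrite iotaD addrAC.
  by move: g1; rewrite ltr_norml => /andP[]; lra.
have c2 : sigma (h + g) < sigma h + e.
  apply: sigma_gt; rewrite iotaD addrAC.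
  by move: g2; rewrite ltr_norml => /andP[]; lra.
by rewrite ltr_norml; apply/andP; split; lra.
Qed.

Let s_sub h g : s (h + g) - s h = iota g + (sigma (h + g) - sigma h) *: p.
Proof. by rewrite /s iotaD scalerBl opprD addrACA (addrC (iota h)) addrK. Qed.

Let s_cont h e : 0 < e ->
  exists2 d : R, 0 < d & forall g, `|g| < d -> `|s (h + g) - s h| < e.
Proof.
move=> e0; have e1 : 0 < e / (2 * P) by rewrite divr_gt0// mulr_gt0.
have [d d0 Hd] := sigma_cont h e1.
exists (Num.min d (e / (2 * C))); first by rewrite lt_min d0 divr_gt0// mulr_gt0.
move=> g; rewrite lt_min => /andP[/Hd gd gC]; rewrite s_sub.
apply: (le_lt_trans (ler_normD _ _)); rewrite normrZ.
have h1 := iota_le g.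
have h2 : C * `|g| < e / 2 by move: gC; rewrite !ltr_pdivlMr ?mulr_gt0//; lra.
have h3 : `|sigma (h + g) - sigma h| * `|p| <= `|sigma (h + g) - sigma h| * P.
  by rewrite ler_wpM2l.
have h4 : `|sigma (h + g) - sigma h| * P < e / 2.
  by move: gd; rewrite !ltr_pdivlMr ?mulr_gt0//; lra.
lra.
Qed.

(** Differentiating T(iota h + sigma(h) p) = theta gives L(iota g) + sigma'(h)g L(p) = 0, hence the
    stated differential; L(p) is nonzero. *)
Lemma level_set_graph_C1 : C1_with (fun h => iota h + sigma h *: p)
  (fun h g => iota g - (L (s h) (iota g) / L (s h) p) *: p).
Proof.
move=> h; have [Llin [CL CL0 LC] TLh Lcont] := TL (s h).
have := Lp (s h); set l := L (s h) p => l_neq0.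
have l0 : 0 < `|l| by rewrite normr_gt0.
have Liota g : `|L (s h) (iota g)| <= CL * (C * `|g|).
  by rewrite (le_trans (LC _))// ler_wpM2l// ltW.
split.
- move=> a g g'; rewrite iota_lin Llin mulrDl scalerBr scalerA scalerDl.
  by rewrite opprD addrACA -[a *: L _ _]/(a * _) mulrA.
- exists (C + CL * C / `|l| * P) => [|g].
    by rewrite addr_gt0// mulr_gt0// divr_gt0// mulr_gt0.
  rewrite (le_trans (ler_normB _ _))// mulrDl lerD// normrZ normrM normfV.
  apply: (@le_trans _ _ (CL * (C * `|g|) / `|l| * P)).
    by apply: ler_pM => //; rewrite ler_wpM2r.
  by rewrite le_eqVlt; apply/orP; left; apply/eqP; ring.
- move=> e e0.
  pose M := 2 * (CL * C + C) / `|l|.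
  have M0 : 0 < M by rewrite divr_gt0// mulr_gt0// addr_gt0// mulr_gt0.
  have CMP0 : 0 < P * (C + M * P) by rewrite mulr_gt0// addr_gt0// mulr_gt0.
  (* The first two bounds yield |D| <= M |g| below, by absorbing e1 P |D| into |l| |D| / 2; the
     third is what the final estimate requires. *)
  pose e1 := Num.min 1 (Num.min (`|l| / (2 * P)) (e * `|l| / (P * (C + M * P)))).
  have e10 : 0 < e1.
    by rewrite !lt_min ltr01 !divr_gt0 ?mulr_gt0// addr_gt0// mulr_gt0.
  have e11 : e1 <= 1 by rewrite ge_min lexx.
  have e12 : e1 * (2 * P) <= `|l|.
    by rewrite -ler_pdivlMr ?mulr_gt0// !ge_min lexx orbT.
  have e13 : e1 * (P * (C + M * P)) <= e * `|l|.
    by rewrite -ler_pdivlMr// !ge_min lexx !orbT.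
  clearbody e1.
  have [d1 d10 H1] := TLh e1 e10.
  have [d d0 Hd] := s_cont h d10.
  exists d => // g /Hd/H1.
  (* T takes the value theta at both points, so its expansion says that L(iota g + D p) itself is
     small. *)
  rewrite subrKC !T_sigma subrr sub0r normrN s_sub.
  set D := sigma (h + g) - sigma h; clearbody D.
  have -> : L (s h) (iota g + D *: p) = L (s h) (iota g) + D * l.
    by rewrite addrC Llin addrC.
  move=> key.
  have key2 : `|L (s h) (iota g) + D * l| <= e1 * (C * `|g| + `|D| * P).
    apply: (le_trans key); rewrite ler_wpM2l ?(ltW e10)//.
    by rewrite (le_trans (ler_normD _ _))// normrZ lerD// ler_wpM2l.
  have DM : `|D| <= M * `|g|.
    have t1 : `|D| * `|l| <= `|L (s h) (iota g) + D * l| + `|L (s h) (iota g)|.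
      have E0 : (L (s h) (iota g) + D * l) - L (s h) (iota g) = D * l by ring.
      by rewrite -normrM -{1}E0 ler_normB.
    have t2 : e1 * (2 * P) * `|D| <= `|l| * `|D| by rewrite ler_wpM2r.
    have t3 : e1 * (C * `|g|) <= 1 * (C * `|g|) by rewrite ler_wpM2r// mulr_ge0//
      ltW.
    have := Liota g; rewrite /M mulrAC ler_pdivlMr//.
    lra.
  have -> : iota g + D *: p - (iota g - (L (s h) (iota g) / l) *: p) =
      ((L (s h) (iota g) + D * l) / l) *: p.
    rewrite mulrDl mulfK// scalerDl opprB addrC addrA subrK; reflexivity.
  rewrite normrZ normrM normfV -mulrA mulrCA ler_pdivrMl//.
  apply: (@le_trans _ _ (e1 * (C * `|g| + `|D| * P) * P)); first exact: ler_pM.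
  apply: (@le_trans _ _ (e1 * (P * (C + M * P)) * `|g|)); last first.
    by have := ler_wpM2r (normr_ge0 g) e13; lra.
  have : `|D| * P <= M * `|g| * P by rewrite ler_wpM2r// ltW.
  move=> /(ler_wpM2l (ltW (mulr_gt0 e10 P0))); lra.
move=> e e0.
(* Continuity of a quotient: once |l'| >= |l| / 2, the common denominator l' l has size at least l^2
   / 2, and [e2] makes the numerator small enough. *)
pose e2 := e * l ^+ 2 / (2 * P * (C * `|l| + CL * C * P)).
have l2 : 0 < l ^+ 2 by rewrite lt_def sqr_ge0 sqrf_eq0 l_neq0.
have Q0 : 0 < 2 * P * (C * `|l| + CL * C * P).
  have q1 : 0 < C * `|l| by rewrite mulr_gt0.
  have q2 : 0 < CL * C * P by rewrite !mulr_gt0.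
  have q3 : 0 < 2 * P by rewrite mulr_gt0.
  by rewrite mulr_gt0// addr_gt0.
pose e1 := Num.min (`|l| / (2 * P)) e2.
have e10 : 0 < e1.
  have q4 : 0 < e * l ^+ 2 by rewrite mulr_gt0.
  have q3 : 0 < 2 * P by rewrite mulr_gt0.
  by rewrite lt_min !divr_gt0.
have e12 : e1 * (2 * P) <= `|l|.
  by rewrite -ler_pdivlMr ?mulr_gt0// ge_min lexx.
have e13 : e1 * (2 * P * (C * `|l| + CL * C * P)) <= e * l ^+ 2.
  by rewrite -ler_pdivlMr// ge_min lexx orbT.
clearbody e1.
have [d1 d10 H1] := Lcont e1 e10.
have [d d0 Hd] := s_cont h d10.
exists d => // h' hh' g.
have sh' : `|s h' - s h| < d1.
  by have := Hd _ hh'; rewrite subrKC.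
have Ly := H1 _ sh'; have := Lp (s h'); set l' := L (s h') p => l'_neq0.
have ll' : `|l' - l| <= e1 * P by rewrite (le_trans (Ly p))// ler_wpM2l// ltW.
have l'0 : `|l| / 2 <= `|l'|.
  have -> : l' = l + (l' - l) by rewrite subrKC.
  have := lerB_normD l (l' - l); lra.
have -> : iota g - (L (s h') (iota g) / l') *:
  p - (iota g - (L (s h) (iota g) / l) *: p)
   = ((L (s h) (iota g) * (l' - l) - (L (s h') (iota g) - L (s h) (iota g)) * l) /
     (l' * l)) *: p.
  rewrite opprB addrC addrA subrK -scalerBl; congr (_ *: _).
  by field; rewrite l_neq0.
rewrite normrZ normrM normfV.
have b1 : `|L (s h) (iota g) * (l' - l) - (L (s h') (iota g) - L (s h) (iota g)) *
  l|
   <= e1 * (C * `|l| + CL * C * P) * `|g|.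
  rewrite (le_trans (ler_normB _ _))// !normrM.
  have c1 := ler_pM (normr_ge0 _) (normr_ge0 _) (Liota g) ll'.
  have c2 : `|L (s h') (iota g) - L (s h) (iota g)| * `|l| <= e1 * (C * `|g|) *
    `|l|.
    by rewrite ler_wpM2r// (le_trans (Ly _))// ler_wpM2l// ltW.
  lra.
have b2 : `|l' * l|^-1 <= 2 / l ^+ 2.
  rewrite -[leRHS]invrK lef_pV2 ?posrE ?invr_gt0 ?divr_gt0//
    ?normr_gt0 ?mulf_neq0//.
  rewrite invf_div normrM -(real_normK (num_real l)) expr2 mulrAC ler_wpM2r//.
apply: (@le_trans _ _ (e1 * (C * `|l| + CL * C * P) * `|g| * (2 / l ^+ 2) * P)).
  by apply: ler_pM => //; apply: ler_pM.
rewrite mulrAC mulrA ler_pdivrMr//.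
by move: e13 => /(ler_wpM2r (normr_ge0 g)); lra.
Qed.

End LevelSetGraph.

(** * Level sets of the phase *)

#[local] Opaque phase dphase.

Section PhaseFunctional.
Variable R : realType.
Variables (phi phi' : R -> R).
Hypothesis dphi : forall x : R, is_derive x 1 phi (phi' x).
Hypothesis cphi' : continuous phi'.
Implicit Types (u h w : sobolevD R).

Definition phase_of (phi : R -> R) u : R := phase (fun t => phi (u t)).

Definition dphase_of u h : R := dphase (fun t => phi (u t)) (fun t =>
  phi' (u t) * h t).

Lemma phi_continuous : continuous phi.
Proof. by move=> x; exact: is_derive_cont (dphi x). Qed.

Lemma sobolevD_comp_cbounded (psi : R -> R) u : continuous psi ->
  exists K, cbounded K (fun t => psi (u t)).
Proof.
by move=> cpsi; have [B bu] := sobolevD_cbounded u; exact: cbounded_comp cpsi bu.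
Qed.

(** The two bounds place c within |d| of a and in every [-B, B] containing a and a + d, whatever the
    sign of d. *)
Lemma mvt_increment (a d : R) : exists c, [/\ `|c - a| <= `|d|,
  `|c| <= Num.max `|a| `|a + d| & phi (a + d) - phi a = phi' c * d].
Proof.
have cphi := phi_continuous; case: (ltgtP d 0) => [d0|d0|->].
- have ad : a + d < a by rewrite gtrDl.
  have [c /andP[c1 c2] e] := mvt_cont ad cphi (fun x _ => dphi x).
  exists c; split; first by rewrite !ler0_norm; lra.
    rewrite le_max; apply/orP; case: (leP 0 c) => c0; [left|right].
      by rewrite !ger0_norm; lra.
    by rewrite !ler0_norm; lra.
  by rewrite -opprB e; ring.
- have ad : a < a + d by rewrite ltrDl.
  have [c /andP[c1 c2] e] := mvt_cont ad cphi (fun x _ => dphi x).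
  exists c; split; first by rewrite !ger0_norm; lra.
    rewrite le_max; apply/orP; case: (leP 0 c) => c0; [right|left].
      by rewrite !ger0_norm; lra.
    by rewrite !ler0_norm; lra.
  by rewrite e; ring.
- by exists a; split; rewrite ?addr0 ?subrr ?mulr0 ?normr0 ?le_max ?lexx.
Qed.

(** Chain rule through the sup norm: [phase_taylor], [dphase_bound] and [dphase_lip] handle the
    dependence on q, and uniform continuity of phi' on a compact interval handles u |-> phi(u).
    Since phi is only C^1, the second remainder is small relative to |h|, not quadratic. *)
Lemma phase_of_C1 : C1_with (phase_of phi : sobolevD R -> R^o) dphase_of.
Proof.
have cphi := phi_continuous; have [C C0 HC] := @sobolevD_sup R.
have lin u (a : R) h k : dphase_of u (a *: h + k) = a * dphase_of u h + dphase_of u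
  k.
  have [K bK] := sobolevD_comp_cbounded u cphi;
    have [M [cM _]] := sobolevD_comp_cbounded u cphi'.
  have ch := @sobolevD_continuous _ h; have ck := @sobolevD_continuous _ k.
  rewrite /dphase_of -(dphaseD a bK (continuous_mul cM ch) (continuous_mul cM ck)).
  congr dphase; apply/funext => t.
  have -> : (a *: h + k : sobolevD R) t = a * h t + k t by [].
  by ring.
(* [-B, B] contains the values of every w with C |w - u| <= 1, so the constants below serve a whole
   neighbourhood of u. *)
move=> u; pose B := C * `|u| + 1.
have B0 : 0 <= B by rewrite addr_ge0// mulr_ge0// ltW.
have uB t : `|u t| <= B by rewrite (le_trans (HC _ _))// lerDl.
have near_u w : C * `|w - u| <= 1 -> forall t, `|w t| <= B.
  move=> wu t; have -> : w t = u t + (w - u : sobolevD R) t by rewrite [_ t in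
    RHS]/= subrKC.
  by rewrite (le_trans (ler_normD _ _))// lerD// (le_trans (HC _ _)).
have [K K0 phiK] := continuous_bounded_itv (- B) B cphi.
have [M1 M10 phiM] := continuous_bounded_itv (- B) B cphi'.
pose M := M1 + 1; have M0 : 0 < M by rewrite ltr_wpDl.
have bq w : (forall t, `|w t| <= B) -> cbounded K (fun t => phi (w t)).
  move=> wB; split; first exact: continuous_fcomp (@sobolevD_continuous _ w) cphi.
  by move=> t; apply: phiK; rewrite -ler_norml.
have bd w h : (forall t, `|w t| <= B) -> cbounded (M * C * `|h|) (fun t =>
  phi' (w t) * h t).
  move=> wB; split.
    have c1 := continuous_fcomp (@sobolevD_continuous _ w) cphi'.
    by have c2 := @sobolevD_continuous _ h; continuity.
  move=> t; rewrite normrM -mulrA ler_pM// (le_trans (phiM _ _)) ?lerDl//.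
  by rewrite -ler_norml.
have lipB a d : `|a| <= B -> `|a + d| <= B -> `|phi (a + d) - phi a| <= M * `|d|.
  move=> aB adB; have [c [_ cB ->]] := mvt_increment a d.
  rewrite normrM ler_wpM2r// (le_trans (phiM _ _)) ?lerDl//.
  by rewrite -ler_norml (le_trans cB)// ge_max aB.
have [G1 G10 HG1] := dphase_bound K0.
have [G2 G20 HG2] := phase_taylor K0.
have [G3 G30 HG3] := dphase_lip K0.
have bu := bq u uB.
have Lbound h : `|dphase_of u h| <= (G1 * (M * C) + 1) * `|h|.
  rewrite (le_trans (HG1 _ _ _ bu (bd u h uB))) // [leRHS]mulrDl mulrA lerDl mul1r;
    exact: normr_ge0.
have MC0 : 0 < M * C by rewrite mulr_gt0.
have binc w : C * `|w - u| <= 1 -> cbounded (M * C * `|w - u|) (fun t =>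
  phi (w t) - phi (u t)).
  move=> wu; have c1 := (bq w (near_u w wu)).1; have c2 := bu.1; split;
    first by continuity.
  move=> t; have e : w t = u t + (w - u : sobolevD R) t by rewrite [_ t in RHS]/=
    subrKC.
  rewrite {1}e (le_trans (lipB _ _ _ _))// -?e ?near_u//.
  by rewrite -mulrA ler_wpM2l// ltW.
split.
- by move=> a h k; exact: lin.
- by exists (G1 * (M * C) + 1) => //; rewrite ltr_wpDl// mulr_ge0// ltW.
- move=> e e0.
  pose e1 := e / (2 * (G1 * C + 1)).
  have G1C : 0 < 2 * (G1 * C + 1) by rewrite mulr_gt0// ltr_wpDl// mulr_ge0// ltW.
  have e10 : 0 < e1 by rewrite divr_gt0.
have e1E : e1 * (2 * (G1 * C + 1)) = e by rewrite /e1 divfK// gt_eqF.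
clearbody e1.
  have [d d0 Hd] := continuous_uniform_itv B cphi' e10.
  pose Q := 2 * (G2 * (M * C) ^+ 2 + 1).
  have Q0 : 0 < Q by rewrite mulr_gt0// ltr_wpDl// mulr_ge0// sqr_ge0.
  exists (Num.min (C^-1) (Num.min (d / C) (e / Q))).
    by rewrite !lt_min invr_gt0 C0 !divr_gt0.
  move=> h; rewrite !lt_min => /and3P[h1 h2 h3].
  have {}h1 : C * `|h| <= 1 by rewrite -ler_pdivlMl ?mulr1 ?ltW.
  have {}h2 : C * `|h| < d by rewrite mulrC -ltr_pdivlMr.
  have {}h3 : `|h| * Q <= e by rewrite -ler_pdivlMr ?ltW.
  have wu : C * `|u + h - u| <= 1 by rewrite (addrC u) addrK.
  have bk := binc _ wu; rewrite (addrC u) addrK (addrC h) in bk.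
  have br : cbounded (e1 * (C * `|h|))
      (fun t => -1 * (phi' (u t) * h t) + (phi ((u + h :
        sobolevD R) t) - phi (u t))).
    have c1 := (bd u h uB).1; have c2 := bk.1; split; first by continuity.
    move=> t; have -> : (u + h : sobolevD R) t = u t + h t by [].
    have [c [cu _ ->]] := mvt_increment (u t) (h t).
    rewrite mulN1r addrC -mulrBl normrM ler_pM//.
    by apply: Hd => //; rewrite (le_lt_trans cu)// (le_lt_trans (HC _ _)).
  have t1 := HG2 _ _ _ bu bk.
  have t2 := HG1 _ _ _ bu br.
  rewrite (dphaseD (-1) bu (bd u h uB).1 bk.1) -/(dphase_of u h) in t2.
  have E : (fun t => phi (u t) + (phi ((u + h :
    sobolevD R) t) - phi (u t))) = (fun t => phi ((u + h : sobolevD R) t)).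
    by apply/funext => t; rewrite addrC subrK.
  rewrite E -/(phase_of phi (u + h)) -/(phase_of phi u) in t1.
  move: t1 t2; move: (dphase (fun t => phi (u t)) (fun t => phi ((u + h :
    sobolevD R) t) - phi (u t))) => D t1 t2.
  have -> : phase_of phi (u + h) - phase_of phi u - dphase_of u h =
     (phase_of phi (u + h) - phase_of phi u - D) + (-1 * dphase_of u h + D) by ring.
  rewrite (le_trans (ler_normD _ _))// (le_trans (lerD t1 t2))//.
  have -> : e * `|h| = e / 2 * `|h| + e / 2 * `|h| by lra.
  apply: lerD.
    rewrite exprMn expr2 mulrA mulrA ler_wpM2r//.
    have : 0 <= G2 * (M * C) ^+ 2 by rewrite mulr_ge0// sqr_ge0.
    have : 0 <= `|h| by [].
    move: h3; rewrite /Q; nra.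
  rewrite !mulrA ler_wpM2r//.
  by lra.
move=> e e0.
pose e1 := e / (2 * (G1 * C + 1)).
have G1C : 0 < 2 * (G1 * C + 1) by rewrite mulr_gt0// ltr_wpDl// mulr_ge0// ltW.
have e10 : 0 < e1 by rewrite divr_gt0.
have e1E : e1 * (2 * (G1 * C + 1)) = e by rewrite /e1 divfK// gt_eqF.
clearbody e1.
have [d d0 Hd] := continuous_uniform_itv B cphi' e10.
pose e2 := e / (2 * (G3 * (M * C) + 1)).
have G3C : 0 < 2 * (G3 * (M * C) + 1) by rewrite mulr_gt0// ltr_wpDl// mulr_ge0//
  ltW.
have e20 : 0 < e2 by rewrite divr_gt0.
have e2E : e2 * (2 * (G3 * (M * C) + 1)) = e by rewrite /e2 divfK// gt_eqF.
clearbody e2.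
exists (Num.min (C^-1) (Num.min (d / C) (e2 / (M * C)))).
  by rewrite !lt_min invr_gt0 C0 !divr_gt0.
move=> w; rewrite !lt_min => /and3P[h1 h2 h3] h.
have {}h1 : C * `|w - u| <= 1 by rewrite -ler_pdivlMl ?mulr1 ?ltW.
have {}h2 : C * `|w - u| < d by rewrite mulrC -ltr_pdivlMr.
have {}h3 : M * C * `|w - u| <= e2 by rewrite mulrC -ler_pdivlMr ?ltW.
(* The zero direction is set apart because [dphase_lip] takes a positive bound on the direction. *)
have [->|hn0] := eqVneq h 0.
  have L0 v : dphase_of v 0 = 0.
    by have := lin v (-1) 0 0; rewrite scaler0 addr0 mulN1r addNr.
  by rewrite !L0 subrr !normr0 mulr0.
have hp : 0 < `|h| by rewrite normr_gt0.
have wB := near_u w h1.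
have bj := cboundedW h3 (binc w h1).
have E : (fun t => phi (u t) + (phi (w t) - phi (u t))) = (fun t => phi (w t)).
  by apply/funext => t; rewrite addrC subrK.
have bqj : cbounded K (fun t => phi (u t) + (phi (w t) - phi (u t))) by rewrite E;
  exact: bq.
have t1 := HG3 _ _ _ _ _ e20 (mulr_gt0 MC0 hp) bu bj bqj (bd w h wB).
rewrite E -/(dphase_of w h) in t1.
have br : cbounded (e1 * (C * `|h|)) (fun t =>
  -1 * (phi' (u t) * h t) + phi' (w t) * h t).
  have c1 := (bd u h uB).1; have c2 := (bd w h wB).1; split; first by continuity.
  move=> t; rewrite mulN1r addrC -mulrBl normrM ler_pM//.
  apply: Hd => //; rewrite (_ : w t - u t = (w - u : sobolevD R) t)//.
  by rewrite (le_lt_trans (HC _ _)).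
have t2 := HG1 _ _ _ bu br.
rewrite (dphaseD (-1) bu (bd u h uB).1 (bd w h wB).1) -/(dphase_of u h) in t2.
(* [D] has the base point u and the direction phi'(w) h: from w to u the base point changes first,
   by [dphase_lip], then the direction, by [dphase_bound]. *)
move: t1 t2; move: (dphase (fun t => phi (u t)) (fun t => phi' (w t) * h t)) =>
  D t1 t2.
have -> : dphase_of w h - dphase_of u h = (dphase_of w h - D) + (-1 * dphase_of u h
  + D) by ring.
rewrite (le_trans (ler_normD _ _))// (le_trans (lerD t1 t2))//.
have -> : e * `|h| = e / 2 * `|h| + e / 2 * `|h| by lra.
apply: lerD; rewrite !mulrA ler_wpM2r//.
  by lra.
by lra.
Qed.

End PhaseFunctional.

Lemma ivt_between (R : realType) (c : R -> R) (a b y : R) : continuous c ->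
  c a <= y -> y <= c b -> exists s, c s = y.
Proof.
move=> cc ay yb; case: (leP a b) => [ab|/ltW ab];
  have [|s _ <-] := IVT ab (continuous_subspaceT cc) (v := y); try by exists s.
  by rewrite ge_min le_max ay yb orbT.
by rewrite ge_min le_max ay yb !orbT.
Qed.

Section LevelSets.
Variable R : realType.
Variables (phi phi' : R -> R).
Hypothesis dphi : forall x : R, is_derive x 1 phi (phi' x).
Hypothesis cphi' : continuous phi'.
Hypothesis phi'_sg : (forall x, 0 < phi' x) \/ (forall x, phi' x < 0).
Variable p : sobolevD R.
Hypothesis p_gt0 : forall t, t \in `]0, pi[ -> 0 < p t.
Implicit Types (u v w : sobolevD R).

Local Notation Phi := (phase_of phi).
Let cphi : continuous phi. Proof. exact: phi_continuous dphi. Qed.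
Let PhiC1 : C1_with (Phi : sobolevD R -> R^o) (dphase_of phi phi').
Proof. exact: phase_of_C1. Qed.

Let pp t : 0 < t < pi -> 0 < p t.
Proof. by move=> tpi; apply: p_gt0; rewrite in_itv. Qed.

Let p_ge0 t : 0 <= p t.
Proof.
have [/pp/ltW//|/(sobolevD_out p) ->] := boolP (0 < t < pi); exact: lexx.
Qed.

(** The phase decreases in q, so along p it decreases when phi' > 0 and increases when phi' < 0;
    [sg] makes it increase in both cases. *)
Let sg : R := if `[< forall x, 0 < phi' x >] then -1 else 1.

Let phi_mono : (sg = -1 /\ {homo phi : x y / x < y}) \/ (sg = 1 /\ {homo phi :
  x y /~ x < y}).
Proof.
rewrite /sg; case: asboolP => [pos|npos]; [left|right]; split => // x y xy.
  have [c _ e] := mvt_cont xy cphi (fun x _ => dphi x).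
  by rewrite -subr_gt0 e mulr_gt0// subr_gt0.
case: phi'_sg => [//|neg].
have [c _ e] := mvt_cont xy cphi (fun x _ => dphi x).
by rewrite -subr_lt0 e nmulr_rlt0// subr_gt0.
Qed.

Let phi_homo : {homo phi : x y / x < y} \/ {homo phi : x y /~ x < y}.
Proof. by case: phi_mono => -[_ h]; [left|right]. Qed.

Lemma phase_of_mono u s t : s < t -> sg * Phi (u + s *: p) < sg * Phi (u + t *: p).
Proof.
move=> st; have [K1 b1] := sobolevD_comp_cbounded (u + s *: p) cphi.
have [K2 b2] := sobolevD_comp_cbounded (u + t *: p) cphi.
have lt x : 0 < x < pi -> (u + s *: p : sobolevD R) x < (u + t *: p : sobolevD R) x.
  move=> /pp px; have -> : (u + s *: p : sobolevD R) x = u x + s * p x by [].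
  have -> : (u + t *: p : sobolevD R) x = u x + t * p x by [].
  by rewrite ltrD2l ltr_pM2r.
case: phi_mono => -[-> phim].
  rewrite ltr_nM2l ?ltrN10//.
  exact: (phase_lt b1 b2 (fun x tpi => phim _ _ (lt x tpi))).
rewrite ltr_pM2l//.
exact: (phase_lt b2 b1 (fun x tpi => phim _ _ (lt x tpi))).
Qed.

Lemma dphase_of_neq0 u : dphase_of phi phi' u p != 0.
Proof.
have [K b] := sobolevD_comp_cbounded u cphi.
have [K' b'] := sobolevD_comp_cbounded u cphi'.
have cp := @sobolevD_continuous _ p; have c' := b'.1.
have ck : continuous (fun t => phi' (u t) * p t) by continuity.
case: phi'_sg => h.
  by rewrite lt_eqF// (dphase_lt0 b ck)// => t /pp pt; rewrite mulr_gt0.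
have z : continuous (fun _ : R => 0 : R) by exact: continuous_fcst.
have d0 : dphase (fun t => phi (u t)) (fun=> 0) = 0.
  have e := dphaseD (-1) b z z.
  have {}e : dphase (fun t => phi (u t)) (fun=> 0) =
      - dphase (fun t => phi (u t)) (fun=> 0) + dphase (fun t => phi (u t)) (fun=>
        0).
    by rewrite -mulN1r -e; congr dphase; apply/funext => t; rewrite mulr0 addr0.
  by rewrite e addNr.
have := dphaseD (-1) b ck z; rewrite d0 addr0 mulN1r => e.
rewrite gt_eqF// -oppr_lt0 /dphase_of -e.
have cN : continuous (fun t => -1 * (phi' (u t) * p t) + 0) by continuity.
apply: (dphase_lt0 b cN) => t /pp pt.
by rewrite addr0 mulN1r oppr_gt0 nmulr_rlt0.
Qed.

Let ray_continuous u : continuous (fun s : R => Phi (u + s *: p)).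
Proof.
move=> s; apply/cvgrPdist_lt => e e0.
have [d d0 Hd] := C1_with_cont (u + s *: p) PhiC1 e0.
have P0 : 0 < `|p| + 1 by rewrite ltr_wpDl.
have := @nbhsx_ballx _ _ s _ (divr_gt0 d0 P0); apply: filterS => t.
rewrite -ball_normE /= ltr_pdivlMr// => st; rewrite distrC.
have -> : u + t *: p = u + s *: p + (t - s) *: p by rewrite -addrA -scalerDl subrKC.
apply: Hd; rewrite normrZ distrC; apply: le_lt_trans st.
by rewrite ler_wpM2l// lerDl.
Qed.

(** By [phase_range] the line passes below the phase of phi(x1) and above that of phi(x2), for any
    u; the intermediate value theorem does the rest. *)
Lemma ray_hits u x1 x2 theta :
  phase (fun=> phi x1) <= theta -> theta <= phase (fun=> phi x2) ->
  exists s : R, Phi (u + s *: p) = theta.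
Proof.
move=> h1 h2; have [B bu] := sobolevD_cbounded u;
  have [B' bp] := sobolevD_cbounded p.
have [[s1 hs1] _] := phase_range x1 cphi phi_homo bu bp p_ge0 pp.
have [_ [s2 hs2]] := phase_range x2 cphi phi_homo bu bp p_ge0 pp.
have {hs1} l1 : Phi (u + s1 *: p) <= theta by apply: le_trans h1; exact: ltW hs1.
have {hs2} l2 : theta <= Phi (u + s2 *: p) by apply: (le_trans h2); exact: ltW hs2.
exact: ivt_between (@ray_continuous u) l1 l2.
Qed.

(** As |u| <= B, phi(u) lies strictly between the values of phi at - (B + 1) and B + 1. This is the
    converse of [ray_hits]. *)
Lemma phase_of_between u : exists x1 x2, [/\ phi x1 < phi x2,
  phase (fun=> phi x2) < Phi u & Phi u < phase (fun=> phi x1)].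
Proof.
have [B bu] := sobolevD_cbounded u; have [cu uB] := bu.
have B0 := cbounded_ge0 bu.
have [K bK] := sobolevD_comp_cbounded u cphi.
have key x1 x2 : (forall t, phi x1 < phi (u t) < phi x2) ->
    [/\ phi x1 < phi x2, phase (fun=> phi x2) < Phi u & Phi u < phase (fun=>
      phi x1)].
  move=> h; split; first by case/andP: (h 0); exact: lt_trans.
    by apply: (phase_lt bK (cbounded_cst _)) => t _; case/andP: (h t).
  by apply: (phase_lt (cbounded_cst _) bK) => t _; case/andP: (h t).
have uB1 t : - (B + 1) < u t < B + 1.
  by have := uB t; rewrite ler_norml => /andP[]; lra.
case: phi_homo => hm.
  exists (- (B + 1)), (B + 1); apply: key => t; have /andP[a b] := uB1 t.
  by rewrite (hm _ _ a) (hm _ _ b).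
exists (B + 1), (- (B + 1)); apply: key => t; have /andP[a b] := uB1 t.
by rewrite (hm _ _ a) (hm _ _ b).
Qed.

(** By [phase_const] the value j pi is the phase of - j^2. If it is attained, comparison of
    constants puts - j^2 strictly between two values of phi; conversely, if - j^2 = phi(x), the line
    through 0 reaches the phase of phi(x). *)
Lemma level_nonempty (j : nat) : (0 < j)%N ->
  (exists u, Phi u = j%:R * pi) <-> interior (range phi) (- (j%:R ^+ 2)).
Proof.
move=> j0; have Tj := @phase_const R j j0; split.
  move=> [u uj]; have [x1 [x2 [x12 h1 h2]]] := phase_of_between u.
  set y : R := - (j%:R ^+ 2); rewrite uj -Tj -/y in h1 h2.
  have y2 : y < phi x2.
    rewrite ltNge; apply/negP => hy; move: h1; rewrite ltNge => /negP; apply.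
    exact: (phase_le (cbounded_cst _) (cbounded_cst _)).
  have y1 : phi x1 < y.
    rewrite ltNge; apply/negP => hy; move: h2; rewrite ltNge => /negP; apply.
    exact: (phase_le (cbounded_cst _) (cbounded_cst _)).
  have : \forall z \near y, phi x1 < z /\ z < phi x2.
    by near=> z; split; near: z; [exact: lt_nbhsr|exact: lt_nbhsl].
  apply: filterS => z [z1 z2].
  by have [c <-] := ivt_between cphi (ltW z1) (ltW z2); exists c.
move=> /interior_subset[x _ xE].
have [||s hs] := @ray_hits 0 x x (j%:R * pi); rewrite ?xE ?Tj//.
by exists (0 + s *: p).
Unshelve. all: by end_near. Qed.

Let pp_gt0 : 0 < l2prod p p. Proof. exact: l2prod_self_gt0. Qed.

Lemma orth_coord_lin (a : R) u v : orth_coord p (a *: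
  u + v) = a * orth_coord p u + orth_coord p v.
Proof.
rewrite /orth_coord; have -> : l2prod (a *: u + v) p = a * l2prod u p + l2prod v p.
  exact: (l2prod_linl a (sqint_sobolevD u) (sqint_sobolevD v) (sqint_sobolevD p)).
by rewrite mulrDl mulrA.
Qed.

Lemma orth_proj_ray (h : orth p) (s : R) : orth_proj p (orth_val h + s *: p) = h.
Proof.
apply/val_inj; rewrite /= (addrC (orth_val h)) orth_coord_lin.
have -> : orth_coord p (orth_val h) = 0.
  by rewrite /orth_coord; have := orth_valP h; rewrite inE => /eqP ->;
    rewrite mul0r.
have -> : orth_coord p p = 1 by rewrite /orth_coord divff// gt_eqF.
by rewrite mulr1 addr0 (addrC (s *: p)) addrK.
Qed.

Lemma orth_proj_C1 : C1_with (orth_proj p) (fun=> orth_proj p).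
Proof.
have [C C0 HC] := orth_coord_bound p.
apply: (@C1_with_linear _ _ _ _ (1 + C * `|p|)).
- move=> a u v; apply/val_inj => /=; rewrite orth_coord_lin.
  by rewrite scalerBr scalerA scalerDl opprD addrACA.
- by rewrite ltr_pwDl// mulr_ge0// ltW.
move=> u; rewrite orth_normE /= (le_trans (ler_normB _ _))// mulrDl mul1r lerD//.
by rewrite normrZ mulrAC ler_wpM2r.
Qed.

(** One point u0 bounds theta by the phases of two constants, so every line along p meets the level
    set, and by monotonicity only once: the level set is the graph of [sigma] over H. *)
Lemma phase_level_diffeo theta : (exists u, Phi u = theta) ->
  C1_diffeo_on [set u | Phi u = theta] (orth_proj p).
Proof.
move=> [u0 u0E].
have hit u : exists s : R, Phi (u + s *: p) = theta.
  have [x1 [x2 [_ /ltW h1 /ltW h2]]] := phase_of_between u0.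
  by rewrite u0E in h1 h2; exact: ray_hits h1 h2.
have PhiB : C1_with ((fun u => Phi u - theta) : sobolevD R ->
  R^o) (dphase_of phi phi').
  move=> u; have [a b c d] := PhiC1 u; split=> // e e0.
  have [d' d'0 Hd] := c e e0; exists d' => // h /Hd.
  by rewrite opprB addrA subrK.
have inj u s t : Phi (u + s *: p) = Phi (u + t *: p) -> s = t.
  have irr (a b : R) : a = b -> ~ sg * a < sg * b by move=> ->; rewrite ltxx.
  move=> e; case: (ltgtP s t) => [st|ts|//]; exfalso.
    exact: irr e (phase_of_mono u st).
  exact: irr (esym e) (phase_of_mono u ts).
have /choice[sigma sigmaE] : forall h : orth p, exists s : R,
  Phi (orth_val h + s *: p) = theta.
  by move=> h; exact: hit.
split.
- move=> u uM; exists setT, (fun u => Phi u - theta); split => //.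
  + exact: openT.
  + exact: C1_with_on PhiB.
  + move=> v _ /=; split; first by move=> ->; rewrite subrr.
    by move/eqP; rewrite subr_eq0 => /eqP.
  move=> v _ _; exists p; rewrite (C1_with_diff v PhiB).2.
  exact: dphase_of_neq0.
- split.
  + by [].
  + move=> u v /set_mem /= uE /set_mem /= vE uv.
    have ud := orth_proj_decomp p u; have vd := orth_proj_decomp p v.
    rewrite ud vd uv; congr (_ + _ *: _).
    by apply: (inj (orth_val (orth_proj p v))); rewrite -vd -uv -ud uE vE.
  + move=> h _; exists (orth_val h + sigma h *: p); first exact: sigmaE.
    exact: orth_proj_ray.
- move=> u _; exists setT, (orth_proj p); split.
  + exact: openT.
  + exact: I.
  + exact: C1_with_on orth_proj_C1.
  + by move=> y _ _; reflexivity.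
exists (fun h : orth p => orth_val h + sigma h *: p); split.
- exact: sigmaE.
- by move=> h; exact: orth_proj_ray.
apply: C1_with_on.
apply: (@level_set_graph_C1 R _ _ Phi (dphase_of phi phi') (@orth_val R p) p 1 sg
  theta sigma) => //.
- by move=> h; rewrite mul1r.
- exact: dphase_of_neq0.
- by move=> u s t; exact: phase_of_mono.
Qed.

End LevelSets.

Theorem theoremC (R : realType) (r : nat) (f : R -> R) (r_ge2 : (2 <= r)%N)
    (f_Cr : is_Cr r f)
    (f_cvx : (forall x, 0 < derive1n 2 f x) \/ (forall x, derive1n 2 f x < 0))
    (p : sobolevD R) (p_gt0 : forall t, t \in `]0, pi[ -> 0 < p t) :
  (forall j : nat, (0 < j)%N ->
     C_ f j !=set0 <-> interior (range (derive1 f)) (- (j%:R ^+ 2))) /\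
  (forall theta : R, M_ f theta !=set0 ->
     C1_diffeo_on (M_ f theta) (orth_proj p)).
Proof.
have deriv k (x : R) : (k < r)%N -> is_derive x 1 (derive1n k f) (derive1n k.+1 f
  x).
  move=> kr; have [d _] := f_Cr; rewrite derive1nS derive1E.
  exact/derivableP/d.
(* For r = 2 this is the continuity clause of [is_Cr]; for r > 2, f'' is differentiable. *)
have cf2 : continuous (derive1n 2 f).
  move: r_ge2; rewrite leq_eqVlt => /predU1P[r2|r2]; first by rewrite r2; case:
    f_Cr.
  by move=> x; exact: is_derive_cont (deriv 2%N x r2).
have dphi (x : R) : is_derive x 1 (derive1 f) (derive1n 2 f x) by exact:
  (deriv 1%N x).
have cphi : continuous (derive1 f) by move=> x; exact: is_derive_cont (dphi x).
have argE u : argW f u pi = phase_of (derive1 f) u.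
  by have [K bK] := sobolevD_comp_cbounded u cphi; rewrite (argW_phase bK).
have ME theta : M_ f theta = [set u | phase_of (derive1 f) u = theta].
  by apply/seteqP; split=> u /=; rewrite /M_ /= argE.
split=> [j j0|theta].
  rewrite /C_ ME; exact: (level_nonempty dphi cf2 f_cvx p_gt0 j0).
rewrite ME; exact: (phase_level_diffeo dphi cf2 f_cvx p_gt0).
Qed.
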